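(* There are no entire graphs $M^3$ of $\mathbb{R}^4$ with zero scalar curvature ($R=0$ everywhere) and such that, for some constant $c>0$, $$\frac{(-K)}{H^3}\geq c>0$$ everywhere on $M$. Here $H$ denotes the mean curvature and $K$ the Gauss-Kronecker curvature of the immersion.
   Context: An entire graph $M^3$ of $\mathbb{R}^4$ is the graph $\{(y,F(y)):y\in\mathbb{R}^3\}$ of a smooth function $F:\mathbb{R}^3\to\mathbb{R}$. If $\lambda_1,\lambda_2,\lambda_3$ are the eigenvalues of the second fundamental form (with respect to a unit normal field), then $$R=\lambda_1\lambda_2+\lambda_1\lambda_3+\lambda_2\lambda_3,\quad H=\lambda_1+\lambda_2+\lambda_3,\quad K=\lambda_1\lambda_2\lambda_3$$ (scalar curvature, non-normalized mean curvature, Gauss-Kronecker curvature). The condition $(-K)/H^3\ge c$ includes that $H$ is nowhere zero; the quotient $K/H^3$ does not depend on the choice of orientation. *)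

(* Defs.v *)
From HB Require Import structures.
From mathcomp Require Import all_boot all_order all_algebra.
From mathcomp Require Import all_classical all_reals all_analysis.

Set Implicit Arguments.
Unset Strict Implicit.
Unset Printing Implicit Defensive.

Import Order.TTheory GRing.Theory Num.Theory.
Import numFieldNormedType.Exports.

Local Open Scope ring_scope.

Section Calculus.
Context {R : realType}.

Definition partial {V : normedModType R} (i : 'I_3) (f : 'rV[R]_3 -> V) :
    'rV[R]_3 -> V :=
  fun y => 'D_(delta_mx 0 i) f y.

(* C^oo: every iterated partial derivative, of any order (including 0) and
   taken in any order of the variables, is differentiable, hence continuous. *)
Definition smooth (F : 'rV[R]_3 -> R) : Prop :=
  forall (s : seq 'I_3) (y : 'rV[R]_3), differentiable (foldr partial F s) y.

(* The norm carried by 'rV[R]_n in the library is the sup norm, so the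
   Euclidean structure is introduced separately. *)
Definition dot {n : nat} (u v : 'rV[R]_n) : R := \sum_(i < n) u 0 i * v 0 i.

End Calculus.

Section Hypersurface.
Context {R : realType}.
Variables X N : 'rV[R]_3 -> 'rV[R]_4.

Definition first_fundamental_form (y : 'rV[R]_3) : 'M[R]_3 :=
  \matrix_(i, j) dot (partial i X y) (partial j X y).

Definition second_fundamental_form (y : 'rV[R]_3) : 'M[R]_3 :=
  \matrix_(i, j) dot (partial i (partial j X) y) (N y).

(* The matrix, in the coordinate basis, of the endomorphism of the tangent
   space that represents the second fundamental form with respect to the
   induced metric. *)
Definition shape_operator (y : 'rV[R]_3) : 'M[R]_3 :=
  invmx (first_fundamental_form y) *m second_fundamental_form y.

(* The entries of [k] are the eigenvalues of the second fundamental form at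
   [y], listed with multiplicity. *)
Definition principal_curvatures (y : 'rV[R]_3) (k : 'rV[R]_3) : Prop :=
  char_poly (shape_operator y) = \prod_(i < 3) ('X - (k 0 i)%:P).

End Hypersurface.

Section Graph.
Context {R : realType}.
Variable F : 'rV[R]_3 -> R.

Definition graph_param (y : 'rV[R]_3) : 'rV[R]_4 :=
  row_mx y (F y)%:M : 'rV[R]_(3 + 1).

Definition graph_conormal (y : 'rV[R]_3) : 'rV[R]_4 :=
  row_mx (- \row_(i < 3) partial i F y) 1%:M : 'rV[R]_(3 + 1).

(* The upward unit normal field (- grad F, 1) / sqrt (1 + |grad F|^2). *)
Definition graph_normal (y : 'rV[R]_3) : 'rV[R]_4 :=
  (Num.sqrt (dot (graph_conormal y) (graph_conormal y)))^-1 *: graph_conormal y.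

Definition graph_principal_curvatures (y k : 'rV[R]_3) : Prop :=
  principal_curvatures graph_param graph_normal y k.

End Graph.

Section Curvatures.
Context {R : realType}.
Variable k : 'rV[R]_3.

Let k1 := k 0 0.
Let k2 := k 0 1.
Let k3 := k 0 2%:R.

Definition scalar_curvature : R := k1 * k2 + k1 * k3 + k2 * k3.
Definition mean_curvature : R := k1 + k2 + k3.
Definition gauss_kronecker_curvature : R := k1 * k2 * k3.

End Curvatures.

(* Main.v *)
Require Import Defs.
From mathcomp Require Import all_boot all_order all_algebra.
From mathcomp Require Import all_classical all_reals all_analysis.
From mathcomp Require Import ring lra zify.
Import Order.TTheory GRing.Theory Num.Theory.
Import numFieldNormedType.Exports.
Local Open Scope ring_scope.

(* Put u = F, W = sqrt (1 + |Du|^2), P = D^2 u, and consider on R^3 the vector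
   field Z = adj(P) Du / W^2. Cofactor matrices of Hessians are divergence free,
   so div Z = det P (W^2 + 2) / W^4 = K W (W^2 + 2). When R = 0 the principal
   curvatures satisfy |k|^2 = H^2, which gives |Z| <= C (|H| W)^2, whereas
   -K / H^3 >= c gives |div Z| >= c (|H| W)^3, with a constant sign. Hence
   |Z| <= C' (div Z)^(2/3), up to the sign of Z. Testing with a cutoff m, Young's
   inequality bounds the integral of m^6 div Z by that of |Dm|^3 m^3, and a
   logarithmic cutoff makes the latter arbitrarily small in dimension 3; so
   div Z = 0, contradicting H <> 0. No integral is needed: the smallness of
   the integral of |Dm|^3 is expressed by an explicit compactly supported radial
   field, added to m^6 Z so that the total divergence is nonnegative and
   somewhere positive, which is impossible for a compactly supported field. *)

(** * Compactly supported fields *)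

(** Both sides have the same difference quotient as a function of the increment. This transfers
    one-variable results, such as the mean value theorem and the chain rule, to directional
    derivatives. *)
Lemma is_derive_lineP {R : realType} {V : normedModType R} (f : V -> R)
    (df : R) (x v : V) (t : R) :
  is_derive (t *: v + x) v f df <-> is_derive t 1 (fun s => f (s *: v + x)) df.
Proof.
have E : (fun h => h^-1 *: (((fun s => f (s *: v + x)) \o shift t) (h *: 1)
                 - f (t *: v + x))) =
  (fun h => h^-1 *: ((f \o shift (t *: v + x)) (h *: v) - f (t *: v + x))).
  by apply/funext => h /=; rewrite scalerDl [h%:A]mulr1 addrA.
split=> -[fd <-]; apply: DeriveDef.
- by rewrite /derivable E.
- by rewrite /derive E.
- by move: fd; rewrite /derivable E.
- by rewrite /derive E.
Qed.

Lemma MVT_line {R : realType} {V : normedModType R} (f df : V -> R) (x v : V)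
    (h : R) :
  0 < h -> (forall y, is_derive y v f (df y)) ->
  exists t, [/\ 0 < t, t < h & f (h *: v + x) - f x = h * df (t *: v + x)].
Proof.
move=> h0 fdf.
have fl (t : R) : is_derive t 1 (fun s => f (s *: v + x)) (df (t *: v + x)).
  by apply/(is_derive_lineP f _ x v t).
have [|t] := @MVT R (fun s => f (s *: v + x)) (fun t => df (t *: v + x)) 0 h h0.
  by apply: derivable_within_continuous => t _; apply: ex_derive.
rewrite in_itv/= => /andP[t0 th]; rewrite subr0 scale0r add0r => E.
by exists t; split => //; rewrite E mulrC.
Qed.

(** Compactness enters in its near-covering form. Only [x] is confined to [K]: the shifted point
    [h + x] may leave it, as happens at the edge of a grid. *)
Lemma compact_uniform_continuity {R : realType} {V : normedModType R}
    (K : set V) (f : V -> R) (e : R) :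
  compact K -> continuous f -> 0 < e ->
  exists2 d, 0 < d & forall x h, K x -> `|h| < d -> `|f (h + x) - f x| < e.
Proof.
move=> /compact_near_coveringP Kc fc e0.
have /= := Kc _ ((0:R)^'+)%classic
  (fun d x => forall h, `|h| < d -> `|f (h + x) - f x| < e) _ _.
case=> [|d /= d0 H]; last 1 first.
- exists (d / 2) => [|x h Kx hd]; first by rewrite divr_gt0.
  apply: (H (d / 2)) => //=; last by rewrite divr_gt0.
  by rewrite sub0r normrN gtr0_norm ?divr_gt0// ltr_pdivrMr// ltr_pMr// ltr1n.
move=> x Kx.
have /cvgrPdist_lt /(_ (e / 2)) := fc x.
move=> /(_ (divr_gt0 e0 (ltr0n _ 2)))/nbhs_ballP[d /= d0 H].
have d20 : 0 < d / 2 by rewrite divr_gt0.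
(* Halving the radius keeps both [y] and [h + y] within [d] of [x], so two comparisons with [f x]
   suffice. *)
exists (ball x (d / 2), [set r | 0 < r < d / 2]%classic) => /=.
  split; first exact: nbhsx_ballx.
  by near=> r; apply/andP; split; near: r; [exact: nbhs_right_gt|exact: nbhs_right_lt].
move=> [y r] /= [xy /andP[r0 rd]] h hr.
move: xy; rewrite -ball_normE /= => xy.
have fy : `|f x - f y| < e / 2.
  apply: H; rewrite -ball_normE /= (lt_trans xy)//.
  by rewrite ltr_pdivrMr// ltr_pMr// ltr1n.
have fhy : `|f x - f (h + y)| < e / 2.
  apply: H; rewrite -ball_normE /= opprD addrCA [d]splitr.
  rewrite (le_lt_trans (ler_normD _ _))// normrN ltrD//.
  exact: lt_trans rd.
rewrite [X in `|X|](_ : _ = (f x - f y) - (f x - f (h + y))); last by ring.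
by rewrite (le_lt_trans (ler_normB _ _))// [e]splitr ltrD.
Unshelve. all: by end_near. Qed.

(** On each cell the mean value theorem turns the increment of [f] into [h] times an intermediate
    value of [df], and the value at the left end exceeds this by at most [e]. The increments
    telescope to zero because [f] vanishes at both ends. *)
Lemma sum_derive_grid_le {R : realType} (f df : R -> R) (N : nat) (a h e : R) :
  0 < h -> (forall t : R, is_derive t 1 f (df t)) -> f a = 0 -> f (a + N%:R * h) = 0 ->
  (forall t s, a <= t <= a + N%:R * h -> 0 <= s < h -> df t <= df (s + t) + e) ->
  \sum_(i < N) df (a + i%:R * h) <= N%:R * e.
Proof.
move=> h0 fdf fa fb H.
have st (i : 'I_N) : df (a + i%:R * h) <=
    (f (a + i.+1%:R * h) - f (a + i%:R * h)) / h + e.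
  have [t [t0 th]] := @MVT_line R R f df (a + i%:R * h) 1 h h0 (fun y => fdf y).
  rewrite [h%:A]mulr1 [t%:A]mulr1.
  have -> : h + (a + i%:R * h) = a + i.+1%:R * h by rewrite -natr1; ring.
  move=> ->; rewrite mulrAC mulfV ?gt_eqF// mul1r.
  apply: H; last by rewrite (ltW t0).
  have h0' := ltW h0.
  by rewrite lerDl mulr_ge0// lerD2l ler_pM2r// ler_nat ltnW ?andbT.
apply: le_trans (ler_sum _ (fun i _ => st i)) _.
rewrite big_split /= -mulr_suml.
rewrite -(big_mkord xpredT (fun i => f (a + i.+1%:R * h) - f (a + i%:R * h))).
rewrite (telescope_sumr (fun i => f (a + i%:R * h)))//.
by rewrite mul0r addr0 fa fb subrr mul0r add0r sumr_const card_ord mulr_natl.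
Qed.

(** * Coordinates and sup-norm balls in dimension three *)

Lemma ord3_add : (1 + 1 = 2%:R :> 'I_3) * (1 + 2%:R = 0 :> 'I_3) *
  (2%:R + 1 = 0 :> 'I_3) * (2%:R + 2%:R = 1 :> 'I_3).
Proof. by do ![split]; exact: val_inj. Qed.

Lemma ord3P (i : 'I_3) : [\/ i = 0, i = 1 | i = 2%:R].
Proof.
by case: i => -[|[|[|//]]] ?; [apply: Or31|apply: Or32|apply: Or33];
  apply: val_inj.
Qed.

Lemma big_ord3 {R : pzRingType} (f : 'I_3 -> R) :
  \sum_i f i = f 0 + f 1 + f 2%:R.
Proof.
rewrite !big_ord_recr big_ord0 /= add0r.
by congr (f _ + f _ + f _); apply: val_inj.
Qed.

Lemma bounded_ball_compact {R : realType} {n : nat} (r : R) :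
  compact [set y : 'rV[R]_n | `|y| <= r]%classic.
Proof.
apply: bounded_closed_compact.
  by exists r; split; [exact: num_real|move=> x rx y /= /le_trans; apply; exact: ltW].
by have := @closed_closed_ball_ _ _ (0 : 'rV[R]_n) r; rewrite /closed_ball_;
  under eq_set do rewrite sub0r normrN.
Qed.

Lemma normr_coord_le {R : realType} {n : nat} (y : 'rV[R]_n) (i : 'I_n) :
  `|y 0 i| <= `|y|.
Proof. by rewrite [leRHS]/Num.Def.normr/= mx_normrE (le_bigmax _ _ (0, i)). Qed.

Lemma normr_row_le {R : realType} {n : nat} (y : 'rV[R]_n) (r : R) :
  0 <= r -> (forall i, `|y 0 i| <= r) -> `|y| <= r.
Proof.
move=> r0 H; rewrite [leLHS]/Num.Def.normr/= mx_normrE.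
by apply: bigmax_le => // -[i j] _ /=; rewrite [i]ord1.
Qed.

Definition row3 {R : realType} (a b c : R) : 'rV[R]_3 :=
  \row_i [:: a; b; c]`_i.

Lemma row3D {R : realType} (a b c t : R) :
  (row3 (t + a) b c = t *: delta_mx 0 0 + row3 a b c) *
  (row3 a (t + b) c = t *: delta_mx 0 1 + row3 a b c) *
  (row3 a b (t + c) = t *: delta_mx 0 2%:R + row3 a b c).
Proof.
by do ![split]; apply/rowP => -[[|[|[|//]]] ?]; rewrite !mxE /=;
  rewrite ?mulr1 ?mulr0 ?add0r.
Qed.

Lemma normr_row3_le {R : realType} (a b c r : R) :
  `|a| <= r -> `|b| <= r -> `|c| <= r -> `|row3 a b c| <= r.
Proof.
move=> ar br cr; apply: normr_row_le; first exact: le_trans ar.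
by move=> -[[|[|[|//]]] ?]; rewrite mxE.
Qed.

Lemma normr_row3_ge {R : realType} (a b c r : R) :
  r <= `|a| \/ r <= `|b| \/ r <= `|c| -> r <= `|row3 a b c|.
Proof.
move=> [|[|]] /le_trans; apply.
- by have := normr_coord_le (row3 a b c) 0; rewrite mxE.
- by have := normr_coord_le (row3 a b c) 1; rewrite mxE.
- by have := normr_coord_le (row3 a b c) 2%:R; rewrite mxE.
Qed.

(** Used to count the grid points that lie in the unit cube. *)
Lemma sum_indicator_ge {R : realType} (a m N : nat) :
  (a + m <= N)%N -> m%:R <= \sum_(i < N) (a <= i < a + m)%N%:R :> R.
Proof.
move=> aN; rewrite -(big_mkord xpredT (fun i => (a <= i < a + m)%N%:R)).
rewrite (@big_cat_nat _ _ _ (a + m)%N)//= (@big_cat_nat _ _ _ a)/= ?leq_addr//.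
have -> : \sum_(a <= i < a + m) ((a <= i < a + m)%N%:R : R) = m%:R.
  by rewrite big_nat (eq_bigr (fun=> 1)) => [|i -> //]; rewrite -big_nat sumr_const_nat addKn.
rewrite -addrA addrCA ler_wpDr//.
by rewrite addr_ge0// sumr_ge0.
Qed.

(* Riemann sums replace integrals: by the mean value theorem, the sum of
   [\sum_i dV i] over a fine grid telescopes up to a small error. *)
Lemma compact_support_divergence {R : realType}
    (V dV : 'I_3 -> 'rV[R]_3 -> R) (r : nat) (eta : R) :
  (0 < r)%N -> 0 < eta ->
  (forall i y, is_derive y (delta_mx 0 i) (V i) (dV i y)) ->
  (forall i, continuous (dV i)) ->
  (forall i y, r%:R <= `|y| -> V i y = 0) ->
  (forall y, 0 <= \sum_i dV i y) ->
  ~ (forall y, `|y| <= 1 -> eta <= \sum_i dV i y).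
Proof.
move=> r0 eta0 VdV dVc Vr g0 g1.
(* With [N = 2 * r * M] grid points per axis, the total error [3 * N ^+ 3 * e] becomes
   [3 / 4 * eta * M ^+ 3], strictly less than the contribution [eta * M ^+ 3] of the unit cube. *)
pose e := eta / (4 * (2 * r%:R) ^+ 3).
have R0 : 0 < r%:R :> R by rewrite ltr0n.
have e0 : 0 < e by rewrite divr_gt0// mulr_gt0// exprn_gt0// mulr_gt0.
have Kc := @bounded_ball_compact R 3 r%:R.
have [d d0 dP] : exists2 d, 0 < d & forall l x h, `|x| <= r%:R -> `|h| < d ->
    `|dV l (h + x) - dV l x| < e.
  have [d0 d00 H0] := compact_uniform_continuity _ _ _ Kc (dVc 0) e0.
  have [d1 d10 H1] := compact_uniform_continuity _ _ _ Kc (dVc 1) e0.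
  have [d2 d20 H2] := compact_uniform_continuity _ _ _ Kc (dVc 2%:R) e0.
  exists (Num.min d0 (Num.min d1 d2)); first by rewrite !lt_min d00 d10.
  move=> l x h xr; rewrite !lt_min => /and3P[h0 h1 h2].
  by case: (ord3P l) => ->; [exact: H0|exact: H1|exact: H2].
(* The mesh is the inverse of an integer, so that the grid fits both the cube of half-side [r] and
   the unit cube exactly. *)
pose M := (Num.truncn d^-1).+1.
have M0 : 0 < M%:R :> R by rewrite ltr0n.
pose h : R := M%:R^-1.
have h0 : 0 < h by rewrite invr_gt0.
have hd : h < d.
  rewrite -[d]invrK ltf_pV2 ?posrE ?invr_gt0//.
  exact: truncnS_gt.
pose N := (2 * r * M)%N.
have Nh : N%:R * h = 2 * r%:R by rewrite !natrM -mulrA mulfV ?mulr1// gt_eqF.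
pose x (i : nat) : R := - r%:R + i%:R * h.
have xr (i : 'I_N) : `|x i| <= r%:R.
  rewrite ler_norml /x lerDl mulr_ge0 ?(ltW h0)//= addrC lerBlDr.
  have -> : r%:R + r%:R = N%:R * h by rewrite Nh; ring.
  by rewrite ler_pM2r// ler_nat ltnW.
(* Along a line parallel to axis [l], both ends lie where [V l] vanishes, so the telescoping
   estimate applies. *)
have line l (q : R -> 'rV[R]_3) :
    (forall t s, q (s + t) = s *: delta_mx 0 l + q t) ->
    (forall t, `|t| <= r%:R -> `|q t| <= r%:R) ->
    (forall t, r%:R <= `|t| -> r%:R <= `|q t|) ->
  \sum_(i < N) dV l (q (x i)) <= N%:R * e.
  move=> qD qr rq.
  apply: (@sum_derive_grid_le R (V l \o q) (dV l \o q)) => //=.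
  - move=> t.
    have -> : V l \o q = fun s => V l (s *: delta_mx 0 l + q 0).
      by apply/funext => s /=; rewrite -qD addr0.
    by apply/(is_derive_lineP (V l)); rewrite -qD addr0; exact: VdV.
  - by apply/Vr/rq; rewrite normrN ger0_norm// ltW.
  - apply/Vr/rq; rewrite Nh [2 * _]mulr_natl mulr2n addKr.
    by rewrite ger0_norm// ltW.
  - move=> t s /andP[t1 t2] /andP[s0 sh].
    have tr : `|t| <= r%:R.
      rewrite ler_norml t1 (le_trans t2)// Nh; lra.
    have := dP l (q t) (s *: delta_mx 0 l) (qr _ tr).
    rewrite -qD => /(_ _)/ltW; rewrite ler_norml => H.
    have /H/andP[H1 _] : `|s *: (delta_mx 0 l : 'rV[R]_3)| < d.
      rewrite (le_lt_trans _ hd)// (le_trans _ (ltW sh))// normr_row_le//.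
      move=> i; rewrite !mxE eqxx/=; case: eqP => _; rewrite ?mulr0 ?normr0//.
      by rewrite mulr1 ger0_norm.
    by move: H1; lra.
pose g y := \sum_i dV i y.
pose S := \sum_(i < N) \sum_(j < N) \sum_(k < N) g (row3 (x i) (x j) (x k)).
(* Each of the three terms is summed first over its own variable of differentiation. *)
have SE : S = \sum_(j < N) \sum_(k < N) \sum_(i < N) dV 0 (row3 (x i) (x j) (x k))
   + \sum_(i < N) \sum_(k < N) \sum_(j < N) dV 1 (row3 (x i) (x j) (x k))
   + \sum_(i < N) \sum_(j < N) \sum_(k < N) dV 2%:R (row3 (x i) (x j) (x k)).
  rewrite /S.
  under [X in X + _ + _]eq_bigr do rewrite exchange_big/=.
  under [X in _ + X + _]eq_bigr do rewrite exchange_big/=.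
  rewrite [X in X + _ + _]exchange_big/=.
  rewrite -!big_split/=; apply: eq_bigr => i _.
  rewrite -!big_split/=; apply: eq_bigr => j _.
  rewrite -!big_split/=; apply: eq_bigr => k _.
  exact: big_ord3.
have cst1 (G : 'I_N -> R) B : (forall i, G i <= B) -> \sum_i G i <= N%:R * B.
  move=> GB; apply: le_trans (ler_sum _ (fun i _ => GB i)) _.
  by rewrite sumr_const card_ord mulr_natl.
have cst2 (G : nat -> nat -> R) B : (forall i j : 'I_N, G i j <= B) ->
    \sum_(i < N) \sum_(j < N) G i j <= N%:R * (N%:R * B).
  by move=> GB; apply: (cst1) => i; exact: cst1.
have SU : S <= 3 * N%:R ^+ 3 * e.
  have -> : 3 * N%:R ^+ 3 * e = N%:R * (N%:R * (N%:R * e)) +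
    N%:R * (N%:R * (N%:R * e)) + N%:R * (N%:R * (N%:R * e)) by ring.
  rewrite SE; apply: lerD; first apply: lerD.
  - apply: (cst2 (fun j k => \sum_(i < N) dV 0 (row3 (x i) (x j) (x k)))).
    move=> j k; apply: (line 0 (fun t => row3 t (x j) (x k))) => [t s|t tr|t tr].
      exact: (row3D _ _ _ _).1.1.
      exact: normr_row3_le.
    by apply: normr_row3_ge; left.
  - apply: (cst2 (fun i k => \sum_(j < N) dV 1 (row3 (x i) (x j) (x k)))).
    move=> i k; apply: (line 1 (fun t => row3 (x i) t (x k))) => [t s|t tr|t tr].
      exact: (row3D _ _ _ _).1.2.
      exact: normr_row3_le.
    by apply: normr_row3_ge; right; left.
  - apply: (cst2 (fun i j => \sum_(k < N) dV 2%:R (row3 (x i) (x j) (x k)))).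
    move=> i j; apply: (line 2%:R (fun t => row3 (x i) (x j) t)) => [t s|t tr|t tr].
      exact: (row3D _ _ _ _).2.
      exact: normr_row3_le.
    by apply: normr_row3_ge; right; right.
(* The indicator of the [M] indices whose abscissa lies in [[0, 1)]. Grid points outside the
   corresponding cube contribute a nonnegative amount and are discarded. *)
pose chi (i : nat) : R := (r * M <= i < r * M + M)%N%:R.
have chi0 i : 0 <= chi i by [].
have x1 (i : nat) : (r * M <= i < r * M + M)%N -> `|x i| <= 1.
  move=> /andP[i1 i2]; have E : x i = (i%:R - (r * M)%:R) * h.
    by rewrite /x natrM mulrBl -mulrA mulfV ?mulr1 1?addrC// gt_eqF.
  rewrite E -natrB// ger0_norm; last by rewrite mulr_ge0// ltW.
  by rewrite ler_pdivrMr// mul1r ler_nat leq_subLR ltnW.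
have SL : eta * M%:R ^+ 3 <= S.
  apply: (@le_trans _ _ (\sum_(i < N) \sum_(j < N) \sum_(k < N)
      (eta * chi i * chi j) * chi k)); last first.
    apply: ler_sum => i _; apply: ler_sum => j _; apply: ler_sum => k _.
    rewrite /chi; case: (boolP (_ <= i < _)%N) => [/x1 ci|_]; last first.
      by rewrite mulr0 !mul0r; exact: g0.
    case: (boolP (_ <= j < _)%N) => [/x1 cj|_]; last first.
      by rewrite mulr0 !mul0r; exact: g0.
    case: (boolP (_ <= k < _)%N) => [/x1 ck|_]; last first.
      by rewrite mulr0; exact: g0.
    by rewrite !mulr1; apply: g1; exact: normr_row3_le.
  under eq_bigr do under eq_bigr do rewrite -mulr_sumr.
  under eq_bigr do rewrite -mulr_suml -mulr_sumr.
  rewrite -!mulr_suml -mulr_sumr.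
  have cM : M%:R <= \sum_(i < N) chi i.
    by apply: sum_indicator_ge; rewrite -mulSnr leq_mul2r; apply/orP; right; lia.
  rewrite exprS expr2 !mulrA.
  by rewrite !ler_pM// ?mulr_ge0// ?ltW.
have : eta * M%:R ^+ 3 <= 3 * N%:R ^+ 3 * e := le_trans SL SU.
have -> : 3 * N%:R ^+ 3 * e = (3 / 4 * eta) * M%:R ^+ 3.
  rewrite /e /N !natrM; field.
  by rewrite gt_eqF.
rewrite ler_pM2r ?exprn_gt0//; lra.
Qed.

(** * A Liouville theorem for vector fields *)

Lemma is_derive_comp {R : realType} {V : normedModType R} (f : V -> R)
    (g : R -> R) (df dg : R) (x v : V) :
  is_derive (f x) 1 g dg -> is_derive x v f df ->
  is_derive x v (fun y => g (f y)) (dg * df).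
Proof.
move=> gdg fdf; rewrite -[x]add0r -(scale0r v); apply/(is_derive_lineP (fun y => g (f y))).
apply: (@is_derive1_comp _ g (fun s : R => f (s *: v + x))).
  by rewrite scale0r add0r.
by apply/(is_derive_lineP f); rewrite scale0r add0r.
Qed.

Lemma is_derive_coord {R : realType} {n : nat} (i : 'I_n) (x v : 'rV[R]_n) :
  is_derive x v (fun y => y 0 i) (v 0 i).
Proof.
have did : derivable (@id 'rV[R]_n) x v by exact: derivable_id.
apply: DeriveDef; first by have /derivable_mxP := did; exact.
by have := derive_mx did; rewrite derive_id => /matrixP/(_ 0 i); rewrite mxE.
Qed.

(** Squaring removes the kink of the positive part at 0; for this reason the truncated logarithmic
    cutoff is differentiated only through its square. *)
Lemma is_derive_pos_sqr {R : realType} (t : R) :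
  is_derive t 1 (fun s => Num.max 0 s ^+ 2) (2 * Num.max 0 t).
Proof.
case: (ltgtP t 0) => t0.
- rewrite mulr0; apply: (@near_eq_is_derive _ _ _ (cst 0)).
  near=> s; rewrite /cst max_l ?expr0n//.
  by apply: ltW; near: s; exact: lt_nbhsl.
- apply: (@near_eq_is_derive R R R (fun s : R => s ^+ 2)).
  near=> s; rewrite max_r//.
  by apply: ltW; near: s; exact: lt_nbhsr.
  have := @is_deriveX R R (@id R) 2 t 1 1 (is_derive_id _ _).
  by rewrite expr1 [_ *: _]mulr1.
(* At the kink the difference quotient is [h] for positive [h] and 0 otherwise, hence tends to 0. *)
- rewrite t0 mulr0.
  have H : ((fun h : R => h^-1 *: ((fun s : R => Num.max 0 s ^+ 2) (h *: (1 : R) + 0)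
      - Num.max 0 (0 : R) ^+ 2)) h @[h --> 0^'] --> (0 : R))%classic.
    apply/cvgrPdist_le => e e0; near=> h.
    rewrite sub0r normrN [h%:A]mulr1 addr0 maxxx expr0n/= subr0.
    have h0 : h != 0 by near: h; exact: nbhs_dnbhs_neq.
    case: (ltP 0 h) => h1; last by rewrite expr0n scaler0 normr0 ltW.
    rewrite expr2 [_ *: _]mulKf//.
    by near: h; exact: dnbhs0_le.
  by apply: DeriveDef; [apply/cvg_ex; exists 0|apply: cvg_lim].
Unshelve. all: by end_near. Qed.

(* With [rho = sqrt (1 + |y|^2)], [a = rho^-1], [m = max 0 (1 - 2 e ln rho)],
   [D = div Z] and [B = a (y . Z)], the quantity [E] is the divergence of
   [m^6 Z - C2 e^2 m^2 (a^3 + 2 a^5) y]. *)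
Lemma cutoff_bound {R : realType} (C c e m a x B D : R) :
  0 < C -> 0 < c -> 0 < e -> e <= 1 -> 0 <= m -> m <= 1 -> 0 < a -> a <= 1 ->
  0 <= x -> `|B| <= 3 * C * x ^+ 2 -> c * x ^+ 3 <= D ->
  let C2 := 36 * C * (72 * C / c) ^+ 2 in
  let E := m ^+ 6 * D - 12 * e * m ^+ 5 * a * B +
    C2 * e ^+ 2 * (m ^+ 2 * (a ^+ 5 - 10 * a ^+ 7) +
                   4 * m * e * (1 - a ^+ 2) * (a ^+ 3 + 2 * a ^+ 5)) in
  (10 * a ^+ 2 <= 1 -> 0 <= E) /\ m ^+ 6 * D / 2 - 11 * C2 * e ^+ 2 <= E.
Proof.
move=> C0 c0 e0 e1 m0 m1 a0 a1 x0 BC DC C2 E.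
have C20 : 0 <= C2 by rewrite mulr_ge0 ?exprn_ge0 ?divr_ge0// ?mulr_ge0// ltW.
have D0 : 0 <= D by rewrite (le_trans _ DC)// mulr_ge0 ?exprn_ge0// ltW.
have mD : 0 <= m ^+ 6 * D by rewrite mulr_ge0 ?exprn_ge0.
(* Since the gradient of [m] has length at most [2 * e * a], [g] dominates half of [m |Dm|]. *)
pose g := e * m * a.
have g0 : 0 <= g by rewrite !mulr_ge0// ltW.
have young : - (C2 * g ^+ 3) <= m ^+ 6 * D / 2 - 12 * e * m ^+ 5 * a * B.
  pose T := m ^+ 2 * x.
  have T0 : 0 <= T by rewrite mulr_ge0 ?exprn_ge0.
  have h1 : c * T ^+ 3 <= m ^+ 6 * D.
    have -> : c * T ^+ 3 = m ^+ 6 * (c * x ^+ 3) by rewrite /T; ring.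
    by rewrite ler_wpM2l ?exprn_ge0.
  have h2 : 12 * e * m ^+ 5 * a * B <= 36 * C * (T ^+ 2 * g).
    have -> : 36 * C * (T ^+ 2 * g) = 12 * e * m ^+ 5 * a * (3 * C * x ^+ 2).
      by rewrite /T /g; ring.
    rewrite ler_wpM2l ?(le_trans (ler_norm _) BC)//.
    by rewrite !mulr_ge0 ?exprn_ge0// ltW.
  (* Young's inequality by cases: for large [T] the error is absorbed by half of the good term
     [c * T ^+ 3], and for small [T] it is at most [C2 * g ^+ 3]. The threshold fixes the value of
     [C2]. *)
  case: (leP (72 * C / c * g) T) => hT.
    have h3 : 36 * C * (T ^+ 2 * g) <= c * T ^+ 3 / 2.
      have -> : 36 * C * (T ^+ 2 * g) = c * T ^+ 2 / 2 * (72 * C / c * g).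
        by field; rewrite gt_eqF.
      have -> : c * T ^+ 3 / 2 = c * T ^+ 2 / 2 * T by ring.
      by rewrite ler_wpM2l// !mulr_ge0 ?exprn_ge0// ltW.
    have h4 : 0 <= C2 * g ^+ 3 by rewrite mulr_ge0 ?exprn_ge0.
    lra.
  have h3 : 36 * C * (T ^+ 2 * g) <= C2 * g ^+ 3.
    have -> : C2 * g ^+ 3 = 36 * C * ((72 * C / c * g) ^+ 2 * g) by rewrite /C2; ring.
    rewrite ler_wpM2l//; first by rewrite mulr_ge0// ltW.
    by rewrite ler_wpM2r// lerXn2r ?nnegrE ?(ltW hT)// (le_trans T0 (ltW hT)).
  lra.
have EE : m ^+ 6 * D / 2 - C2 * g ^+ 3 + C2 * e ^+ 2 * (m ^+ 2 * (a ^+ 5 - 10 * a ^+ 7) +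
       4 * m * e * (1 - a ^+ 2) * (a ^+ 3 + 2 * a ^+ 5)) <= E by rewrite /E; lra.
have me0 : 0 <= m * e by rewrite mulr_ge0// ltW.
have a20 : 0 <= 1 - a ^+ 2 by rewrite subr_ge0 expr_le1// ltW.
have a3 : 0 <= a ^+ 3 by rewrite exprn_ge0// ltW.
have a5 : 0 <= a ^+ 5 by rewrite exprn_ge0// ltW.
have e2 : 0 <= C2 * e ^+ 2 by rewrite mulr_ge0 ?exprn_ge0// ltW.
have m2 : 0 <= m ^+ 2 by rewrite exprn_ge0.
(* Far out, [a ^+ 5 - 10 * a ^+ 7] is nonnegative and [4 * (1 - a ^+ 2)] exceeds 1, so the radial
   terms dominate the error [m ^+ 3 * e * a ^+ 3]. *)
split=> [ha|].
  apply: le_trans EE; have -> : C2 * g ^+ 3 = C2 * e ^+ 2 * (m ^+ 3 * e * a ^+ 3).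
    by rewrite /g; ring.
  suff : m ^+ 3 * e * a ^+ 3 <= m ^+ 2 * (a ^+ 5 - 10 * a ^+ 7) +
       4 * m * e * (1 - a ^+ 2) * (a ^+ 3 + 2 * a ^+ 5).
    by move=> /(ler_wpM2l e2); lra.
  have h1 : 0 <= m ^+ 2 * (a ^+ 5 - 10 * a ^+ 7).
    rewrite mulr_ge0// (_ : _ - _ = a ^+ 5 * (1 - 10 * a ^+ 2)); last by ring.
    by rewrite mulr_ge0// subr_ge0.
  have h2 : m * e * a ^+ 3 <= 4 * m * e * (1 - a ^+ 2) * (a ^+ 3 + 2 * a ^+ 5).
    have -> : 4 * m * e * (1 - a ^+ 2) * (a ^+ 3 + 2 * a ^+ 5) =
       m * e * (4 * (1 - a ^+ 2) * (a ^+ 3 + 2 * a ^+ 5)) by ring.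
    rewrite ler_wpM2l// (@le_trans _ _ (1 * (a ^+ 3 + 2 * a ^+ 5)))//.
      by rewrite mul1r lerDl mulr_ge0.
    by rewrite ler_wpM2r ?addr_ge0 ?mulr_ge0//; lra.
  have h3 : m ^+ 3 * e * a ^+ 3 <= m * e * a ^+ 3.
    rewrite ler_wpM2r// (_ : m ^+ 3 * e = m ^+ 2 * (m * e)); last by ring.
    by rewrite ler_piMl// expr_le1.
  lra.
(* Near the origin crude bounds suffice: one unit of [C2 * e ^+ 2] for the Young error and ten for
   the radial terms. *)
apply: le_trans EE.
have h1 : C2 * g ^+ 3 <= C2 * e ^+ 2.
  rewrite ler_wpM2l// /g (_ : (e * m * a) ^+ 3 = e ^+ 2 * (e * m ^+ 3 * a ^+ 3)); last by ring.
  rewrite ler_piMr ?exprn_ge0 ?(ltW e0)// mulr_ile1 ?mulr_ile1 ?mulr_ge0 ?exprn_ge0 ?exprn_ile1//;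
   exact: ltW.
have h2 : - 10 <= m ^+ 2 * (a ^+ 5 - 10 * a ^+ 7).
  have h3 : m ^+ 2 * (10 * a ^+ 7) <= 10.
    rewrite mulrCA ler_piMr// mulr_ile1 ?exprn_ge0 ?exprn_ile1//; exact: ltW.
  have h4 : 0 <= m ^+ 2 * a ^+ 5 by exact: mulr_ge0.
  rewrite mulrBr; lra.
have h3 : 0 <= 4 * m * e * (1 - a ^+ 2) * (a ^+ 3 + 2 * a ^+ 5).
  have a35 : 0 <= a ^+ 3 + 2 * a ^+ 5 by rewrite addr_ge0// mulr_ge0.
  by rewrite -[4 * m * e]mulrA; do 2 apply: mulr_ge0 => //; exact: mulr_ge0.
have : C2 * e ^+ 2 * (- 10) <= C2 * e ^+ 2 * (m ^+ 2 * (a ^+ 5 - 10 * a ^+ 7) +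
       4 * m * e * (1 - a ^+ 2) * (a ^+ 3 + 2 * a ^+ 5)).
  by rewrite ler_wpM2l//; lra.
lra.
Qed.

(** * Differentiation and continuity of explicit formulas *)

Lemma is_derive_addf {R : realType} {V : normedModType R} {f g : V -> R}
    {df dg : R} {x v : V} :
  is_derive x v f df -> is_derive x v g dg ->
  is_derive x v (fun y => f y + g y) (df + dg).
Proof. by move=> ? ?; exact: is_deriveD. Qed.

Lemma is_derive_oppf {R : realType} {V : normedModType R} {f : V -> R}
    {df : R} {x v : V} :
  is_derive x v f df -> is_derive x v (fun y => - f y) (- df).
Proof. by move=> ?; exact: is_deriveN. Qed.

Lemma is_derive_mulf {R : realType} {V : normedModType R} {f g : V -> R}
    {df dg : R} {x v : V} :
  is_derive x v f df -> is_derive x v g dg ->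
  is_derive x v (fun y => f y * g y) (df * g x + f x * dg).
Proof.
move=> fd gd; apply: is_derive_eq (is_deriveM fd gd) _.
by rewrite addrC; congr (_ + _); rewrite [LHS]mulrC.
Qed.

Lemma is_derive_expf {R : realType} {V : normedModType R} {f : V -> R}
    {df : R} {n : nat} {x v : V} :
  is_derive x v f df ->
  is_derive x v (fun y => f y ^+ n) (n%:R * f x ^+ n.-1 * df).
Proof. by move=> fd; have := @is_deriveX _ _ f n _ _ _ fd; rewrite exprfctE. Qed.

Lemma is_derive_invf {R : realType} {V : normedModType R} {f : V -> R}
    {df : R} {x v : V} :
  f x != 0 -> is_derive x v f df ->
  is_derive x v (fun y => (f y)^-1) (- (f x) ^- 2 * df).
Proof.
move=> f0 fd; apply: DeriveDef; first exact: derivableV.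
by rewrite deriveV// derive_val.
Qed.

(** Recursion on the written form of the function. [notypeclasses refine] leaves the premises to the
    recursion instead of instance search; at non-constant leaves a derivative present among the
    hypotheses is tried before the coordinate rule. *)
Ltac derive_tac := lazymatch goal with
  | |- is_derive _ _ (fun y => @?f y + @?g y) _ =>
      notypeclasses refine (@is_derive_addf _ _ f g _ _ _ _ _ _); derive_tac
  | |- is_derive _ _ (fun y => - @?f y) _ =>
      notypeclasses refine (@is_derive_oppf _ _ f _ _ _ _); derive_tac
  | |- is_derive _ _ (fun y => @?f y * @?g y) _ =>
      notypeclasses refine (@is_derive_mulf _ _ f g _ _ _ _ _ _); derive_tac
  | |- is_derive _ _ (fun y => @?f y ^+ ?n) _ =>
      notypeclasses refine (@is_derive_expf _ _ f _ n _ _ _); derive_tac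
  | |- is_derive _ _ (fun _ => ?c) _ => exact: is_derive_cst
  | _ => first [eassumption | exact: is_derive_coord]
  end.

Ltac derive_eq := notypeclasses refine (is_derive_eq _ _); [derive_tac|].

Lemma continuous_addf {R : realType} {T : topologicalType} (f g : T -> R) :
  continuous f -> continuous g -> continuous (fun y => f y + g y).
Proof. by move=> fc gc y; apply: cvgD; [exact: fc|exact: gc]. Qed.

Lemma continuous_oppf {R : realType} {T : topologicalType} (f : T -> R) :
  continuous f -> continuous (fun y => - f y).
Proof. by move=> fc y; apply: cvgN; exact: fc. Qed.

Lemma continuous_mulf {R : realType} {T : topologicalType} (f g : T -> R) :
  continuous f -> continuous g -> continuous (fun y => f y * g y).
Proof. by move=> fc gc y; apply: cvgM; [exact: fc|exact: gc]. Qed.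

Lemma continuous_expf {R : realType} {T : topologicalType} (f : T -> R) n :
  continuous f -> continuous (fun y => f y ^+ n).
Proof.
move=> fc y; apply: (@continuous_comp _ _ _ f (fun t => t ^+ n)).
  exact: fc.
exact: exprn_continuous.
Qed.

Lemma continuous_invf {R : realType} {T : topologicalType} (f : T -> R) :
  (forall y, f y != 0) -> continuous f -> continuous (fun y => (f y)^-1).
Proof. by move=> f0 fc y; apply: cvgV; [exact: f0|exact: fc]. Qed.

Ltac continuous_tac := lazymatch goal with
  | |- continuous (fun y => @?f y + @?g y) =>
      apply: (@continuous_addf _ _ f g); continuous_tac
  | |- continuous (fun y => - @?f y) =>
      apply: (@continuous_oppf _ _ f); continuous_tac
  | |- continuous (fun y => @?f y * @?g y) =>
      apply: (@continuous_mulf _ _ f g); continuous_tac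
  | |- continuous (fun y => @?f y ^+ ?n) =>
      apply: (@continuous_expf _ _ f n); continuous_tac
  | |- continuous (fun _ => ?c) => exact: cst_continuous
  | |- continuous (fun y => fun_of_matrix y _ _) => exact: coord_continuous
  | _ => eauto
  end.

(** The exponents 2 and 3 encode a bound of the field by the power 2/3 of its divergence, which is
    critical in dimension 3. There Young's inequality leaves the cube of the gradient of the cutoff,
    and a logarithmic cutoff just controls it. The contradiction comes from the compactly supported
    field [U]. *)
Lemma liouville_field {R : realType} (Z dZ : 'I_3 -> 'rV[R]_3 -> R) (C c : R) :
  0 < C -> 0 < c ->
  (forall i y, is_derive y (delta_mx 0 i) (Z i) (dZ i y)) ->
  (forall i, continuous (Z i)) -> (forall i, continuous (dZ i)) ->
  (forall y, exists x, [/\ 0 <= x, forall i, `|Z i y| <= C * x ^+ 2 &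
     c * x ^+ 3 <= \sum_i dZ i y]) ->
  ~ (forall y, 0 < \sum_i dZ i y).
Proof.
move=> C0 c0 Zd Zc dZc ZC D0.
pose D y := \sum_i dZ i y.
have Dc : continuous D.
  rewrite (_ : D = fun y => dZ 0 y + dZ 1 y + dZ 2%:R y); last first.
    by apply/funext => y; exact: big_ord3.
  by continuous_tac; exact: dZc.
(* Radius 3 is what [s y < 10] allows for each coordinate. *)
have [d d0 dD] : exists2 d, 0 < d & forall y, `|y| <= 3 -> d <= D y.
  have [||x _ xD] := @EVT_min_rV R 3 D _ _ (bounded_ball_compact 3).
  - by exists 0; rewrite /= normr0.
  - exact: continuous_subspaceT.
  - by exists (D x) => [|y y3]; [exact: D0|apply: xD; rewrite inE].
pose C2 := 36 * C * (72 * C / c) ^+ 2.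
have C20 : 0 < C2.
  have t0 : 0 < 72 * C / c by rewrite divr_gt0 ?mulr_gt0.
  by apply: mulr_gt0; [exact: mulr_gt0|exact: exprn_gt0].
(* The first bound makes [m] at least 1/2 where [s y < 10], since there [ln (s y) <= 9]. Then
   [m ^+ 6 * D / 2] is at least [d / 2 ^+ 7], and the second bound makes the loss [11 * C2 * e ^+ 2]
   at most half of this. *)
pose e := Num.min (18^-1) (d / 2 ^+ 8 / (11 * C2)).
have C110 : 0 < 11 * C2 by exact: mulr_gt0.
have d80 : 0 < d / 2 ^+ 8 by apply: divr_gt0 => //; exact: exprn_gt0.
have e0 : 0 < e by rewrite lt_min invr_gt0 ltr0n /= divr_gt0.
have e18 : e <= 18^-1 by rewrite ge_min lexx.
have eC : 11 * C2 * e <= d / 2 ^+ 8.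
  by rewrite mulrC -ler_pdivlMr// ge_min lexx orbT.
have e1 : e <= 1 by lra.
(* This is the square of [rho], built from the Euclidean norm, which unlike the sup norm gives a
   smooth function; hence [1 - e * ln (s y)] equals [1 - 2 e ln rho]. *)
pose s (y : 'rV[R]_3) := 1 + (y 0 0 ^+ 2 + y 0 1 ^+ 2 + y 0 2%:R ^+ 2).
have s1 y : 1 <= s y by rewrite lerDl !addr_ge0// sqr_ge0.
have sy (y : 'rV[R]_3) i : 1 + y 0 i ^+ 2 <= s y.
  rewrite /s; have := sqr_ge0 (y 0 0); have := sqr_ge0 (y 0 1).
  by have := sqr_ge0 (y 0 2%:R); case: (ord3P i) => ->; lra.
have s0 y : 0 < s y by exact: lt_le_trans (s1 y).
pose a y := (Num.sqrt (s y))^-1.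
have a0 y : 0 < a y by rewrite invr_gt0 sqrtr_gt0.
have a1 y : a y <= 1 by rewrite invf_le1 ?sqrtr_gt0// -sqrtr1 ler_wsqrtr.
have a2 y : a y ^+ 2 * s y = 1.
  by rewrite exprVn sqr_sqrtr ?ltW// mulVf// gt_eqF.
have sV y : (s y)^-1 = a y ^+ 2 by rewrite -[LHS]mul1r -(a2 y) mulfK// gt_eqF.
pose m y := Num.max 0 (1 - e * ln (s y)).
have m0 y : 0 <= m y by rewrite le_max lexx.
have m1 y : m y <= 1 by rewrite ge_max ler01 gerBl mulr_ge0 ?ln_ge0// ltW.
pose k := C2 * e ^+ 2.
(* Multiplied by [y], the first term is a smoothed Newtonian field. The second corrects the sign of
   its divergence: minus the divergence of [q y] times [y] is [a ^+ 5 - 10 * a ^+ 7]. The gain that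
   pays for the Young error comes from differentiating the cutoff. *)
pose q y := a y ^+ 3 + 2 * a y ^+ 5.
(* This is the derivative of [m ^+ 2], not of [m]. *)
pose dm i y := - (4 * e * m y * a y ^+ 2 * y 0 i).
pose dq i y := - ((3 * a y ^+ 5 + 10 * a y ^+ 7) * y 0 i).
have sd i y : is_derive y (delta_mx 0 i) s (2 * y 0 i).
  rewrite /s; derive_eq.
  case: (ord3P i) => ->; rewrite !mxE /=; ring.
have ad i y : is_derive y (delta_mx 0 i) a (- (a y ^+ 3 * y 0 i)).
  have sqd := is_derive_comp s Num.sqrt _ _ _ _ (is_derive1_sqrt (s0 y)) (sd i y).
  apply: is_derive_eq.
    by apply: is_derive_invf sqd; rewrite /= gt_eqF// sqrtr_gt0.
  by rewrite -exprVn -/(a y) invfM -/(a y); field.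
pose m2 y := m y ^+ 2.
have md i y : is_derive y (delta_mx 0 i) m2 (dm i y).
  have ld := is_derive_comp s _ _ _ _ _ (is_derive1_ln (s0 y)) (sd i y).
  notypeclasses refine (is_derive_eq _ _).
    notypeclasses refine (is_derive_comp (fun y => 1 - e * ln (s y)) _ _ _ _ _
      (is_derive_pos_sqr _) _).
    by derive_tac.
  by rewrite sV -/(m y) /dm; ring.
have qd i y : is_derive y (delta_mx 0 i) q (dq i y).
  have ady := ad i y.
  rewrite /q; derive_eq.
  by rewrite /dq /=; ring.
have sc : continuous s by rewrite /s; continuous_tac.
have ac : continuous a.
  apply: continuous_invf => [y|y]; first by rewrite gt_eqF// sqrtr_gt0.
  by apply: (@continuous_comp _ _ _ s Num.sqrt); [exact: sc|exact: sqrt_continuous].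
have mc : continuous m.
  have lc : continuous (fun y => ln (s y)).
    by move=> y; apply: (@continuous_comp _ _ _ s (@ln R));
      [exact: sc|exact: continuous_ln].
  have tc : continuous (fun y => 1 - e * ln (s y)) by continuous_tac.
  move=> y; apply: (@continuous_max _ _ (cst 0) (fun y => 1 - e * ln (s y))).
    exact: cst_continuous.
  exact: tc.
have [r r0 rm] : exists2 r, (0 < r)%N & forall y, r%:R <= `|y| -> m y = 0.
  (* The cutoff vanishes once [s y] reaches [expR e^-1], and [s y] dominates its square root (as it
     is at least 1), which dominates the sup norm of [y]. *)
  exists (Num.truncn (expR e^-1)).+1 => // y ry; apply/max_l.
  rewrite subr_le0 mulrC -ler_pdivrMr// div1r -[leLHS]expRK ler_ln ?posrE ?expR_gt0//.
  have h1 : expR e^-1 <= `|y| by rewrite (le_trans _ ry)// ltW// truncnS_gt.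
  have h2 : `|y| <= Num.sqrt (s y).
    apply: normr_row_le; first exact: sqrtr_ge0.
    by move=> i; rewrite -sqrtr_sqr ler_wsqrtr//; have := sy y i; lra.
  apply: le_trans h1 (le_trans h2 _).
  rewrite -[leRHS]sqr_sqrtr ?(ltW (s0 y))// expr2 ler_peMl ?sqrtr_ge0//.
  by rewrite -sqrtr1 ler_wsqrtr.
pose U i y := m2 y ^+ 3 * Z i y - k * (m2 y * (q y * y 0 i)).
pose dU i y := 3 * (m y ^+ 2) ^+ 2 * dm i y * Z i y + (m y ^+ 2) ^+ 3 * dZ i y
  - k * (dm i y * (q y * y 0 i) + m y ^+ 2 * (dq i y * y 0 i + q y)).
have Ud i y : is_derive y (delta_mx 0 i) (U i) (dU i y).
  have mdy := md i y; have qdy := qd i y; have Zdy := Zd i y.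
  rewrite /U; derive_eq.
  by rewrite /dU /m2 mxE !eqxx /=; ring.
have Uc i : continuous (dU i).
  have qc : continuous q by rewrite /q; continuous_tac.
  have dmc : continuous (dm i) by rewrite /dm; continuous_tac.
  have dqc : continuous (dq i) by rewrite /dq; continuous_tac.
  by rewrite /dU; continuous_tac.
have UE y : \sum_i dU i y = m y ^+ 6 * D y - 12 * e * m y ^+ 5 * a y *
   (a y * (y 0 0 * Z 0 y + y 0 1 * Z 1 y + y 0 2%:R * Z 2%:R y)) +
    C2 * e ^+ 2 * (m y ^+ 2 * (a y ^+ 5 - 10 * a y ^+ 7) +
           4 * m y * e * (1 - a y ^+ 2) * (a y ^+ 3 + 2 * a y ^+ 5)).
  have ay : 1 - a y ^+ 2 = a y ^+ 2 * (y 0 0 ^+ 2 + y 0 1 ^+ 2 + y 0 2%:R ^+ 2).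
    by rewrite -(a2 y) /s; ring.
  rewrite /D !big_ord3 /dU /dm /dq /q -/k.
  (* The squared length of [y] is first collected into factors [a ^+ 2 * |y|^2], so that [ay] can
     eliminate it. *)
  transitivity (m y ^+ 6 * (dZ 0 y + dZ 1 y + dZ 2%:R y) - 12 * e * m y ^+ 5 * a y *
   (a y * (y 0 0 * Z 0 y + y 0 1 * Z 1 y + y 0 2%:R * Z 2%:R y)) +
    k * (m y ^+ 2 * ((3 * a y ^+ 3 + 10 * a y ^+ 5) *
       (a y ^+ 2 * (y 0 0 ^+ 2 + y 0 1 ^+ 2 + y 0 2%:R ^+ 2))
        - 3 * (a y ^+ 3 + 2 * a y ^+ 5)) + 4 * m y * e *
        (a y ^+ 2 * (y 0 0 ^+ 2 + y 0 1 ^+ 2 + y 0 2%:R ^+ 2))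
           * (a y ^+ 3 + 2 * a y ^+ 5))); first by ring.
  by rewrite -ay; ring.
have ya (y : 'rV[R]_3) i : a y * `|y 0 i| <= 1.
  rewrite mulrC ler_pdivrMr ?sqrtr_gt0// mul1r -sqrtr_sqr ler_wsqrtr//.
  by have := sy y i; lra.
have UP y : (10 * a y ^+ 2 <= 1 -> 0 <= \sum_i dU i y) /\
    m y ^+ 6 * D y / 2 - 11 * C2 * e ^+ 2 <= \sum_i dU i y.
  have [x [x0 ZCx xD]] := ZC y; rewrite UE; apply: cutoff_bound xD => //.
  have b i : `|a y * (y 0 i * Z i y)| <= C * x ^+ 2.
    rewrite mulrA !normrM (gtr0_norm (a0 y)) -[leRHS]mul1r.
    by rewrite ler_pM// mulr_ge0// ltW.
  rewrite !mulrDr (le_trans (ler_normD _ _))//.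
  have := ler_normD (a y * (y 0 0 * Z 0 y)) (a y * (y 0 1 * Z 1 y)).
  have := b 0; have := b 1; have := b 2%:R; lra.
have small y : s y < 10 -> d / 2 ^+ 8 <= \sum_i dU i y.
  move=> s10; apply: le_trans (UP y).2.
  have y3 : `|y| <= 3.
    apply: normr_row_le => // i; rewrite -(@ler_pXn2r _ 2)// ?nnegrE//.
    by rewrite real_normK ?num_real//; have := sy y i; lra.
  have mh : 2^-1 <= m y.
    rewrite le_max; apply/orP; right.
    have l9 : ln (s y) <= 9.
      have := @le_ln1Dx R (s y - 1); rewrite addrCA subrr addr0 => H.
      by apply: le_trans (H _) _; have := s1 y; lra.
    have : e * ln (s y) <= 18^-1 * 9.
      by rewrite ler_pM// ?ln_ge0// ltW.
    lra.
  have h1 : 2^-1 ^+ 6 * d <= m y ^+ 6 * D y.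
    have i2 : 0 <= 2^-1 :> R by rewrite invr_ge0.
    apply: ler_pM; [exact: exprn_ge0|exact: ltW|by rewrite lerXn2r ?nnegrE|exact: dD].
  have h2 : 11 * C2 * e ^+ 2 <= d / 2 ^+ 8.
    apply: le_trans eC; rewrite expr2 mulrA ler_piMr//.
    by apply: ltW; exact: mulr_gt0.
  have : m y ^+ 6 * D y / 2 - 11 * C2 * e ^+ 2 >= 2^-1 ^+ 6 * d / 2 - d / 2 ^+ 8.
    by apply: lerB => //; rewrite ler_pM2r ?invr_gt0.
  by apply: le_trans; rewrite exprVn; lra.
apply: (@compact_support_divergence R U dU r (d / 2 ^+ 8) r0) => //.
- move=> i y /rm my; rewrite /U /m2 my; ring.
- move=> y; case: (ltP (s y) 10) => [/small|s10].
    exact/le_trans/ltW.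
  by apply: (UP y).1; rewrite mulrC -[leRHS](a2 y) ler_pM2l// exprn_gt0.
(* On the unit cube [s y] is at most 4. *)
- move=> y y1; apply: small.
  have y2 i : y 0 i ^+ 2 <= 1.
    rewrite -real_normK ?num_real// expr_le1//.
    exact: le_trans (normr_coord_le _ _) y1.
  by have := y2 0; have := y2 1; have := y2 2%:R; rewrite /s; lra.
Qed.

(** * Symmetry of mixed derivatives and divergence of the curvature field *)

Lemma is_derive_translate {R : realType} {V : normedModType R} (f : V -> R)
    (df : R) (w x v : V) :
  is_derive (w + x) v f df -> is_derive x v (fun y => f (w + y)) df.
Proof.
have E : (fun h => h^-1 *: (((fun y => f (w + y)) \o shift x) (h *: v)
                 - f (w + x))) =
  (fun h => h^-1 *: ((f \o shift (w + x)) (h *: v) - f (w + x))).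
  by apply/funext => h /=; rewrite [w + (_ + _)]addrCA.
move=> [fd <-]; apply: DeriveDef; first by rewrite /derivable E.
by rewrite /derive E.
Qed.

(** The mean value theorem is applied along [v] to the difference of [f] and its translate, then
    along [u] to [fv]. The left-hand side is symmetric in [u] and [v]. *)
Lemma second_difference {R : realType} {V : normedModType R}
    (f fv fuv : V -> R) (u v x : V) (h : R) : 0 < h ->
  (forall y, is_derive y v f (fv y)) -> (forall y, is_derive y u fv (fuv y)) ->
  exists s t, [/\ 0 < s < h, 0 < t < h &
    f (h *: u + (h *: v + x)) - f (h *: v + x) - (f (h *: u + x) - f x) =
    h ^+ 2 * fuv (s *: u + (t *: v + x))].
Proof.
move=> h0 fvd fuvd.
have gd y : is_derive y v (fun y => f (h *: u + y) - f y) (fv (h *: u + y) - fv y).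
  exact: (is_derive_addf (is_derive_translate _ _ _ _ _ (fvd _))
    (is_derive_oppf (fvd y))).
have [t [t0 th E]] := MVT_line _ _ x v h h0 gd.
have [s [s0 sh E']] := MVT_line _ _ (t *: v + x) u h h0 fuvd.
by exists s, t; split; rewrite ?s0 ?t0//; rewrite E E' mulrA expr2.
Qed.

(** The symmetric second difference equals [h ^+ 2] times either mixed derivative, each at its own
    point near [x]; continuity at [x] then identifies the two values. *)
Lemma mixed_derivativeC {R : realType} {V : normedModType R}
    (f fu fv fuv fvu : V -> R) (u v x : V) :
  (forall y, is_derive y u f (fu y)) -> (forall y, is_derive y v f (fv y)) ->
  (forall y, is_derive y v fu (fvu y)) -> (forall y, is_derive y u fv (fuv y)) ->
  {for x, continuous fuv} -> {for x, continuous fvu} -> fuv x = fvu x.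
Proof.
move=> fud fvd fvud fuvd cuv cvu; apply/eqP; rewrite -subr_eq0 -normr_eq0.
rewrite eq_le normr_ge0 andbT; apply/ler_addgt0Pr => e e0; rewrite add0r.
have e20 : 0 < e / 2 by rewrite divr_gt0.
have /cvgrPdist_lt /(_ _ e20) /nbhs_ballP[d1 /= d10 H1] := cuv.
have /cvgrPdist_lt /(_ _ e20) /nbhs_ballP[d2 /= d20 H2] := cvu.
pose d := Num.min d1 d2; have d0 : 0 < d by rewrite lt_min d10.
(* Both intermediate points are then within [d] of [x]; the summand 1 covers the case of zero
   directions. *)
pose h := d / (`|u| + `|v| + 1).
have n0 : 0 < `|u| + `|v| + 1 by rewrite ltr_wpDl// addr_ge0.
have h0 : 0 < h by rewrite divr_gt0.
have near s t (a b : V) : `|a| + `|b| = `|u| + `|v| -> 0 < s < h -> 0 < t < h ->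
    `|x - (s *: a + (t *: b + x))| < d.
  move=> ab /andP[s0 sh] /andP[t0 th].
  rewrite addrA opprD addrCA subrr addr0 normrN.
  rewrite (le_lt_trans (ler_normD _ _))// !normrZ !gtr0_norm//.
  apply: (@le_lt_trans _ _ (h * (`|a| + `|b|))).
    by rewrite mulrDr lerD// ler_wpM2r// ltW.
  by rewrite ab /h mulrAC ltr_pdivrMr// ltr_pM2l// ltrDl.
have [s [t [sh th E]]] := @second_difference _ _ _ _ _ u v x h h0 fvd fuvd.
have [s' [t' [sh' th' E']]] := @second_difference _ _ _ _ _ v u x h h0 fud fvud.
have EE : fuv (s *: u + (t *: v + x)) = fvu (s' *: v + (t' *: u + x)).
  apply: (@mulfI _ (h ^+ 2)); first by rewrite expf_neq0 ?gt_eqF.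
  by rewrite -E -E' [h *: v + (_ + _)]addrCA; ring.
have k1 : `|fuv x - fuv (s *: u + (t *: v + x))| < e / 2.
  apply: H1; rewrite -ball_normE /=.
  by apply: lt_le_trans (near s t u v _ sh th) _; rewrite ?ge_min ?lexx.
have k2 : `|fvu x - fvu (s' *: v + (t' *: u + x))| < e / 2.
  apply: H2; rewrite -ball_normE /=.
  apply: lt_le_trans (near s' t' v u _ sh' th') _; first exact: addrC.
  by rewrite ge_min lexx orbT.
rewrite (_ : _ - _ = (fuv x - fuv (s *: u + (t *: v + x))) -
  (fvu x - fvu (s' *: v + (t' *: u + x)))); last by rewrite EE; ring.
by rewrite (le_trans (ler_normB _ _))// [leRHS]splitr lerD// ltW.
Qed.

Section SmoothField.
Context {R : realType}.
Variable F : 'rV[R]_3 -> R.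
Hypothesis smoothF : smooth F.

Lemma smooth_is_derive (s : seq 'I_3) i y :
  is_derive y (delta_mx 0 i) (foldr partial F s) (partial i (foldr partial F s) y).
Proof. exact/derivableP/diff_derivable/smoothF. Qed.

Lemma smooth_continuous (s : seq 'I_3) : continuous (foldr partial F s).
Proof. by move=> y; exact/differentiable_continuous/smoothF. Qed.

Lemma smooth_partialC (s : seq 'I_3) i j :
  partial i (partial j (foldr partial F s)) =
  partial j (partial i (foldr partial F s)).
Proof.
apply/funext => y; apply: (@mixed_derivativeC _ _ (foldr partial F s)
  (partial i (foldr partial F s)) (partial j (foldr partial F s)) _ _
  (delta_mx 0 i) (delta_mx 0 j)) => [z|z|z|z||].
- exact: smooth_is_derive.
- exact: smooth_is_derive.
- exact: (smooth_is_derive (i :: s)).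
- exact: (smooth_is_derive (j :: s)).
- exact: (smooth_continuous [:: i, j & s]).
- exact: (smooth_continuous [:: j, i & s]).
Qed.

End SmoothField.

(* Indices are taken modulo 3, which absorbs the signs of the cofactors. *)
Definition cof3 {R : comNzRingType} (A : 'I_3 -> 'I_3 -> R) (i j : 'I_3) : R :=
  A (i + 1) (j + 1) * A (i + 2%:R) (j + 2%:R) -
  A (i + 1) (j + 2%:R) * A (i + 2%:R) (j + 1).

Section CurvatureField.
Context {R : realType}.
Variables (u : 'I_3 -> 'rV[R]_3 -> R) (P : 'I_3 -> 'I_3 -> 'rV[R]_3 -> R).
Variable T : 'I_3 -> 'I_3 -> 'I_3 -> 'rV[R]_3 -> R.
Hypothesis uc : forall i, continuous (u i).
Hypothesis Pc : forall i j, continuous (P i j).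
Hypothesis Tc : forall i j k, continuous (T i j k).
Hypothesis ud : forall i j y, is_derive y (delta_mx 0 i) (u j) (P i j y).
Hypothesis Pd : forall i j k y, is_derive y (delta_mx 0 i) (P j k) (T i j k y).
Hypothesis PC : forall i j, P i j = P j i.
Hypothesis Tij : forall i j k, T i j k = T j i k.
Hypothesis Tjk : forall i j k, T i j k = T i k j.

(** In the application [u], [P] and [T] are the first, second and third derivatives of [F], so this
    is [W ^+ 2]. *)
Definition slope2 y := 1 + (u 0 y ^+ 2 + u 1 y ^+ 2 + u 2%:R y ^+ 2).

Definition cof_grad i y := \sum_j cof3 (fun i j => P i j y) i j * u j y.

Definition curvature_field i y := cof_grad i y / slope2 y.

Definition hess_det y := \sum_j P 0 j y * cof3 (fun i j => P i j y) 0 j.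

Lemma slope2_gt0 y : 0 < slope2 y.
Proof. by rewrite ltr_pwDl// !addr_ge0// sqr_ge0. Qed.

Lemma curvature_field_continuous i : continuous (curvature_field i).
Proof.
rewrite (_ : curvature_field i = fun y => (
   cof3 (fun i j => P i j y) i 0 * u 0 y + cof3 (fun i j => P i j y) i 1 * u 1 y
   + cof3 (fun i j => P i j y) i 2%:R * u 2%:R y) * (slope2 y)^-1); last first.
  by apply/funext => y; rewrite /curvature_field /cof_grad big_ord3.
have sc : continuous (fun y => (slope2 y)^-1).
  apply: continuous_invf => [y|]; first by rewrite gt_eqF// slope2_gt0.
  by rewrite /slope2; continuous_tac.
by rewrite /cof3; continuous_tac.
Qed.

Lemma hess_det_continuous : continuous hess_det.
Proof.
rewrite (_ : hess_det = fun y => P 0 0 y * cof3 (fun i j => P i j y) 0 0 +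
  P 0 1 y * cof3 (fun i j => P i j y) 0 1 +
  P 0 2%:R y * cof3 (fun i j => P i j y) 0 2%:R); last first.
  by apply/funext => y; exact: big_ord3.
by rewrite /cof3; continuous_tac.
Qed.

(** In the divergence of [cof_grad] the third derivatives cancel by symmetry, leaving three times
    the determinant. Differentiating the denominator [w] subtracts [2 * (w - 1) / w ^+ 2] times the
    determinant, and [3 / w - 2 * (w - 1) / w ^+ 2] is [(w + 2) / w ^+ 2]. *)
Lemma curvature_field_derive : exists dZ : 'I_3 -> 'rV[R]_3 -> R,
  [/\ forall i y, is_derive y (delta_mx 0 i) (curvature_field i) (dZ i y),
      forall i, continuous (dZ i) &
      forall y, \sum_i dZ i y = hess_det y * (slope2 y + 2) / slope2 y ^+ 2].
Proof.
pose C i j y := cof3 (fun i j => P i j y) i j.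
pose dC i j y := T i (i + 1) (j + 1) y * P (i + 2%:R) (j + 2%:R) y +
  P (i + 1) (j + 1) y * T i (i + 2%:R) (j + 2%:R) y -
  (T i (i + 1) (j + 2%:R) y * P (i + 2%:R) (j + 1) y +
   P (i + 1) (j + 2%:R) y * T i (i + 2%:R) (j + 1) y).
pose N i y := C i 0 y * u 0 y + C i 1 y * u 1 y + C i 2%:R y * u 2%:R y.
pose dN i y := dC i 0 y * u 0 y + C i 0 y * P i 0 y +
  (dC i 1 y * u 1 y + C i 1 y * P i 1 y) +
  (dC i 2%:R y * u 2%:R y + C i 2%:R y * P i 2%:R y).
pose w := slope2.
pose iw y := (w y)^-1.
pose dw i y := 2 * (u 0 y * P i 0 y + u 1 y * P i 1 y + u 2%:R y * P i 2%:R y).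
have w0 y : w y != 0 by rewrite gt_eqF// slope2_gt0.
have NE i y : cof_grad i y = N i y by exact: big_ord3.
have ZE i : curvature_field i = fun y => N i y * iw y.
  by apply/funext => y; rewrite /curvature_field NE.
exists (fun i y => dN i y * iw y - N i y * (dw i y * iw y ^+ 2)).
have Cd i j y : is_derive y (delta_mx 0 i) (C i j) (dC i j y).
  have := Pd i (i + 1) (j + 1) y; have := Pd i (i + 2%:R) (j + 2%:R) y.
  have := Pd i (i + 1) (j + 2%:R) y; have := Pd i (i + 2%:R) (j + 1) y => ? ? ? ?.
  by rewrite /C /cof3; derive_eq; rewrite /dC; ring.
split=> [i y|i|y].
- have wd : is_derive y (delta_mx 0 i) w (dw i y).
    have := ud i 0 y; have := ud i 1 y; have := ud i 2%:R y => ? ? ?.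
    by rewrite /w /slope2; derive_eq; rewrite /dw /=; ring.
  have iwd : is_derive y (delta_mx 0 i) iw (- (w y) ^- 2 * dw i y).
    exact: is_derive_invf.
  have Nd : is_derive y (delta_mx 0 i) (N i) (dN i y).
    have := ud i 0 y; have := ud i 1 y; have := ud i 2%:R y => ? ? ?.
    have := Cd i 0 y; have := Cd i 1 y; have := Cd i 2%:R y => ? ? ?.
    by rewrite /N; derive_eq; rewrite /dN; ring.
  by rewrite ZE; derive_eq; rewrite -exprVn -/(iw y); ring.
- have Cc j : continuous (C i j) by rewrite /C /cof3; continuous_tac.
  have dCc j : continuous (dC i j) by rewrite /dC; continuous_tac.
  have Nc : continuous (N i) by rewrite /N; continuous_tac.
  have dNc : continuous (dN i) by rewrite /dN; continuous_tac.
  have iwc : continuous iw.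
    apply: continuous_invf => //.
    by rewrite /w /slope2; continuous_tac.
  have dwc : continuous (dw i) by rewrite /dw; continuous_tac.
  by continuous_tac.
- rewrite /hess_det !big_ord3 /iw.
  have o11 : (1 + 1 = 2%:R :> 'I_3) by exact: val_inj.
  have o12 : (1 + 2%:R = 0 :> 'I_3) by exact: val_inj.
  have o21 : (2%:R + 1 = 0 :> 'I_3) by exact: val_inj.
  have o22 : (2%:R + 2%:R = 1 :> 'I_3) by exact: val_inj.
  rewrite /dN /N /dw /dC /C /cof3 !(add0r, o11, o12, o21, o22).
  rewrite ?(PC 1 0) ?(PC 2%:R 0) ?(PC 2%:R 1).
  (* The three indices are sorted by adjacent transpositions, which takes a second pass on the last
     pair, so that equal third derivatives become the same term for [field]. *)
  rewrite ?(Tjk _ 1 0) ?(Tjk _ 2%:R 0) ?(Tjk _ 2%:R 1).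
  rewrite ?(Tij 1 0) ?(Tij 2%:R 0) ?(Tij 2%:R 1).
  rewrite ?(Tjk _ 1 0) ?(Tjk _ 2%:R 0) ?(Tjk _ 2%:R 1).
  have := w0 y; rewrite /w /slope2 => wy.
  by field; exact: wy.
Qed.

End CurvatureField.

(** * Linear algebra of the shape operator *)

Lemma det3E {R : comNzRingType} (A : 'M[R]_3) :
  \det A = \sum_j A 0 j * cof3 A 0 j.
Proof.
rewrite (expand_det_row _ 0) !big_ord3 /cofactor.
rewrite !(expand_det_row _ 0) !big_ord_recl !big_ord0 /cofactor !det_mx11 !mxE /=.
rewrite /cof3 !(add0r, ord3_add).
(* Reading entries through natural numbers identifies ordinals that are equal but built differently,
   so that [ring] sees the same atoms. *)
have [a AE] : exists a : nat -> nat -> R, forall i j : 'I_3, A i j = a i j.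
  by exists (fun m n => A (inord m) (inord n)) => i j; rewrite !inord_val.
by rewrite !AE /= /bump /= !expr0 !expr1 !(modn_small, addn0, add0n) //; ring.
Qed.

Lemma mulmx_cof3 {R : comNzRingType} (A : 'M[R]_3) :
  A *m (\matrix_(i, j) cof3 A j i) = (\det A)%:M.
Proof.
apply/matrixP => i k; rewrite !mxE det3E !big_ord3 !mxE /cof3.
by case: (ord3P i) => ->; case: (ord3P k) => ->;
  rewrite !(add0r, ord3_add) /= ?mulr1n ?mulr0n; ring.
Qed.

Lemma char_poly3_horner {R : comNzRingType} (A : 'M[R]_3) (x : R) :
  (char_poly A).[x] = x ^+ 3 - \tr A * x ^+ 2
    + (cof3 A 0 0 + cof3 A 1 1 + cof3 A 2%:R 2%:R) * x - \det A.
Proof.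
rewrite /char_poly !det3E /mxtrace !big_ord3 /cof3 !(add0r, ord3_add) !mxE /=.
rewrite ?mulr1n ?mulr0n !hornerE /=; ring.
Qed.

Lemma char_poly3_roots {R : realFieldType} (A : 'M[R]_3) (k : 'I_3 -> R) :
  char_poly A = \prod_(i < 3) ('X - (k i)%:P) ->
  [/\ \det A = k 0 * k 1 * k 2%:R, \tr A = k 0 + k 1 + k 2%:R &
     \tr (A *m A) = (k 0 + k 1 + k 2%:R) ^+ 2 -
        2 * (k 0 * k 1 + k 0 * k 2%:R + k 1 * k 2%:R)].
Proof.
move=> Ak.
have H x : (char_poly A).[x] = (x - k 0) * (x - k 1) * (x - k 2%:R).
  rewrite Ak !big_ord_recr big_ord0 /= mul1r !hornerE.
  by congr ((_ - k _) * (_ - k _) * (_ - k _)); apply: val_inj.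
(* Three values of a monic cubic determine its coefficients linearly, which gives Vieta's
   formulas. *)
have := H 0; have := H 1; have := H (-1).
rewrite !char_poly3_horner => H1 H2 H3.
have dA : \det A = k 0 * k 1 * k 2%:R by lra.
have tA : \tr A = k 0 + k 1 + k 2%:R by lra.
split => //; rewrite -tA.
have eA : cof3 A 0 0 + cof3 A 1 1 + cof3 A 2%:R 2%:R =
  k 0 * k 1 + k 0 * k 2%:R + k 1 * k 2%:R by lra.
rewrite -eA /mxtrace !big_ord3 !mxE !big_ord3 /cof3 !(add0r, ord3_add); ring.
Qed.

Lemma mxtrace_sqr_sym {R : comNzRingType} {n : nat} (M : 'M[R]_n) :
  M^T = M -> \tr (M *m M) = \sum_i \sum_j M i j ^+ 2.
Proof.
move=> Ms; rewrite /mxtrace; apply: eq_bigr => i _; rewrite mxE.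
by apply: eq_bigr => j _; rewrite -{2}Ms mxE expr2.
Qed.

(** By symmetry the trace of the square is the sum of the squares of all entries. *)
Lemma sym_entry_le {R : realDomainType} {n : nat} (M : 'M[R]_n) (h : R) i j :
  M^T = M -> \tr (M *m M) = h ^+ 2 -> `|M i j| <= `|h|.
Proof.
move=> Ms Mh; rewrite -(@ler_pXn2r _ 2)// ?nnegrE// !real_normK ?num_real//.
rewrite -Mh mxtrace_sqr_sym// (bigD1 i)//= (bigD1 j)//= -addrA lerDl addr_ge0//.
  by rewrite sumr_ge0// => k _; rewrite sqr_ge0.
by rewrite sumr_ge0// => k _; rewrite sumr_ge0// => l _; rewrite sqr_ge0.
Qed.

Lemma cof3_le {R : realDomainType} (M : 'M[R]_3) (h : R) i j :
  (forall i j, `|M i j| <= h) -> `|cof3 M i j| <= 2 * h ^+ 2.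
Proof.
move=> Mh; rewrite /cof3 (le_trans (ler_normB _ _))// !normrM.
have -> : 2 * h ^+ 2 = h * h + h * h by ring.
by rewrite lerD// ler_pM.
Qed.

Lemma det_add_outer {R : comNzRingType} (p : 'rV[R]_3) :
  \det (1 + p^T *m p) = 1 + \sum_i p 0 i ^+ 2.
Proof.
rewrite det3E !big_ord3 /cof3 !(add0r, ord3_add) !mxE !big_ord1 !mxE /=.
ring.
Qed.

(* With [S] the square root of the inverse metric [(1 + p^T p)^-1], the shape
   operator [A] is similar to the symmetric matrix [M = S^-1 A S]. The factor
   [W ^+ 4] is sharp because [S] shortens [p] by [W]. *)
Lemma graph_cofactor_bound {R : realFieldType} (p : 'rV[R]_3) (P A : 'M[R]_3)
    (W h : R) :
  0 < W -> W ^+ 2 = 1 + \sum_i p 0 i ^+ 2 -> P^T = P -> \det A != 0 ->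
  (1 + p^T *m p) *m A = W^-1 *: P -> \tr (A *m A) = h ^+ 2 ->
  \det P = W ^+ 5 * \det A /\
  forall i, `|\sum_j cof3 P i j * p 0 j| <= 36 * W ^+ 4 * h ^+ 2.
Proof.
move=> W0 W2 Ps A0 EA Ah.
have Wn0 : W != 0 by rewrite gt_eqF.
have W0' := ltW W0.
have W1 : 1 <= W.
  rewrite -(@ler_pXn2r _ 2) ?nnegrE// W2 expr1n lerDl.
  by rewrite sumr_ge0// => i _; rewrite sqr_ge0.
have W1n0 : W + 1 != 0 by rewrite gt_eqF// ltr_wpDl.
have pp : p *m p^T = (W ^+ 2 - 1)%:M.
  apply/matrixP => i j; rewrite !ord1 !mxE W2 addrAC subrr add0r mulr1n.
  by apply: eq_bigr => k _; rewrite mxE expr2.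
pose q := p^T *m p.
have qq : q *m q = (W ^+ 2 - 1) *: q.
  by rewrite /q mulmxA -[p^T *m p *m p^T]mulmxA pp mul_mx_scalar -scalemxAl.
have qs : q^T = q by rewrite /q trmx_mul trmxK.
(* The matrix [q] acts on [p] by [W ^+ 2 - 1] and kills its orthogonal complement. These
   coefficients make [T] and [S] act on [p] by [W] and [W^-1], so [T] is the square root of [1 + q]
   and [S] its inverse. *)
pose a := (W * (W + 1))^-1; pose b := (W + 1)^-1.
pose S : 'M[R]_3 := 1%:M - a *: q; pose T : 'M[R]_3 := 1%:M + b *: q.
have Ss : S^T = S by rewrite /S linearB /= linearZ /= trmx1 qs.
have TS : T *m S = 1%:M.
  rewrite /T /S mulmxBr mulmx1 mulmxDl mul1mx -scalemxAl -scalemxAr qq !scalerA.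
  rewrite -scalerDl -addrA -scalerBl (_ : b - _ = 0) ?scale0r ?addr0//.
  by rewrite /a /b; field; rewrite ?Wn0 ?W1n0.
have ST : S *m T = 1%:M by exact: mulmx1C.
have TT : T *m T = 1 + q.
  rewrite /T mulmxDr mulmx1 mulmxDl mul1mx -scalemxAl -scalemxAr qq !scalerA.
  rewrite -addrA -scalerDl -scalerDl -[q in RHS]scale1r; congr (_ + _ *: _).
  by rewrite /b; field; rewrite ?W1n0.
have Sp : S *m p^T = W^-1 *: p^T.
  rewrite /S mulmxBl mul1mx -scalemxAl /q -mulmxA pp mul_mx_scalar scalerA.
  rewrite -[X in X - _]scale1r -scalerBl; congr (_ *: _).
  by rewrite /a; field; rewrite ?Wn0 ?W1n0.
pose M := T *m A *m S.
have SSP : A = S *m S *m (W^-1 *: P).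
  by rewrite -EA -/q -TT !mulmxA -[S *m S *m T]mulmxA ST mulmx1 ST mul1mx.
have ME : M = W^-1 *: (S *m P *m S).
  by rewrite /M SSP !mulmxA TS mul1mx -scalemxAr -scalemxAl.
have Ms : M^T = M by rewrite ME linearZ /= !trmx_mul Ss Ps mulmxA.
have PE : P = W *: (T *m M *m T).
  rewrite ME -scalemxAr -scalemxAl scalerA divff// scale1r !mulmxA TS mul1mx.
  by rewrite -mulmxA ST mulmx1.
have Mh : \tr (M *m M) = h ^+ 2.
  rewrite -Ah /M !mulmxA -[T *m A *m S *m T]mulmxA ST mulmx1.
  by rewrite mxtrace_mulC !mulmxA ST mul1mx.
have dM : \det M = \det A.
  by rewrite /M !det_mulmx mulrAC -det_mulmx TS det1 mul1r.
have dq : \det (1 + q) = W ^+ 2 by rewrite det_add_outer W2.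
have dPA : \det P = W ^+ 5 * \det A.
  have := congr1 determinant EA; rewrite det_mulmx -/q dq detZ => E.
  by rewrite exprVn in E; rewrite (exprD _ 3 2) -mulrA E mulrA divff ?mul1r// expf_neq0.
have P0 : \det P != 0 by rewrite dPA mulf_neq0// expf_neq0.
split => // i.
pose C N := \matrix_(i, j) cof3 (N : 'M[R]_3) j i.
have Tp : T *m p^T = W *: p^T.
  rewrite -[in RHS](mul1mx p^T) -TS -mulmxA Sp -scalemxAr scalerA divff//.
  by rewrite scale1r.
have PS : P *m S = W *: (T *m M).
  by rewrite {1}PE -scalemxAl -[T *m M *m T *m S]mulmxA TS mulmx1.
(* As [P] is [W] times [T M T] and the adjugate of [T] is [W] times [S], the adjugate of [P] is
   [W ^+ 4] times [S (adj M) S], and the last [S] divides [p] by [W]. The identity is checked after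
   multiplication by the invertible [P]. *)
have X : C P *m p^T = W ^+ 4 *: (W^-1 *: (S *m C M *m p^T)).
  rewrite -[LHS]mul1mx -[RHS]mul1mx -(mulVmx (_ : P \in unitmx)); last first.
    by rewrite unitmxE unitfE.
  rewrite -!mulmxA; congr (_ *m _).
  rewrite [LHS]mulmxA mulmx_cof3 mul_scalar_mx -!scalemxAr scalerA.
  rewrite [P *m (S *m _)]mulmxA PS -scalemxAl -mulmxA [M *m _]mulmxA mulmx_cof3.
  rewrite mul_scalar_mx -scalemxAr Tp !scalerA dPA dM; congr (_ *: _).
  by field.
have Mle k l : `|M k l| <= `|h| by exact: sym_entry_le.
have ple k : `|p 0 k| <= W.
  rewrite -(@ler_pXn2r _ 2) ?nnegrE// real_normK ?num_real// W2.
  by rewrite (bigD1 k)//= addrCA lerDl addr_ge0// sumr_ge0// => j _; exact: sqr_ge0.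
have qle k l : `|q k l| <= W ^+ 2.
  by rewrite /q mxE big_ord1 mxE normrM expr2 ler_pM.
have Sle k l : `|S k l| <= 2.
  have -> : S k l = (k == l)%:R - a * q k l by rewrite /S !mxE.
  rewrite (le_trans (ler_normB _ _))// normrM.
  have a0 : 0 <= a by rewrite invr_ge0 mulr_ge0// addr_ge0.
  have aW : a * W ^+ 2 <= 1.
    rewrite /a mulrC ler_pdivrMr ?mul1r; last by rewrite mulr_gt0// ltr_wpDl.
    by rewrite expr2 ler_wpM2l// lerDl.
  have h1 : `|a| * `|q k l| <= 1.
    by rewrite (le_trans _ aW)// ger0_norm// ler_wpM2l.
  have h2 : `|(k == l)%:R : R| <= 1 by case: eqP => _; rewrite ?normr1 ?normr0.
  by have := lerD h2 h1.
have -> : \sum_j cof3 P i j * p 0 j = (C P *m p^T) i 0.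
  rewrite mxE; apply: eq_bigr => j _; rewrite !mxE; congr (_ * _).
  have PE' k l : P k l = P l k by rewrite -{1}Ps mxE.
  rewrite /cof3 (PE' (i + 1) (j + 1)) (PE' (i + 2%:R) (j + 2%:R)).
  by rewrite (PE' (i + 1) (j + 2%:R)) (PE' (i + 2%:R) (j + 1)) [X in _ - X]mulrC.
have sum3 (f : 'I_3 -> R) B : (forall j, `|f j| <= B) -> `|\sum_j f j| <= 3 * B.
  move=> fB; rewrite (le_trans (ler_norm_sum _ _ _))//.
  by rewrite (le_trans (ler_sum _ (fun j _ => fB j)))// sumr_const card_ord mulr_natl.
have SC j : `|(S *m C M) i j| <= 3 * (2 * (2 * h ^+ 2)).
  rewrite mxE; apply: sum3 => k; rewrite normrM [C M _ _]mxE ler_pM//.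
  by rewrite (le_trans (cof3_le _ _ _ _ Mle))// real_normK ?num_real.
have Y : `|\sum_j (S *m C M) i j * p^T j 0| <= 3 * (3 * (2 * (2 * h ^+ 2)) * W).
  by apply: sum3 => j; rewrite [p^T j 0]mxE normrM ler_pM.
rewrite X mxE [X in _ * X]mxE [X in _ * (_ * X)]mxE mulrA normrM.
(* The constant is 3 for each of two sums, 2 for the entries of [S] and 2 for the cofactors of
   [M]. *)
have -> : 36 * W ^+ 4 * h ^+ 2 = W ^+ 4 / W * (3 * (3 * (2 * (2 * h ^+ 2)) * W)).
  by field.
have w0 : 0 <= W ^+ 4 / W by rewrite divr_ge0// exprn_ge0.
by rewrite ger0_norm// ler_wpM2l.
Qed.

(** * Fundamental forms of a graph *)

Lemma derive_row_mx {R : realType} {V : normedModType R} {n : nat}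
    (a : V -> 'rV[R]_n) (g : V -> R) (v y : V) :
  derivable a y v -> derivable g y v ->
  'D_v (fun z => row_mx (a z) (g z)%:M : 'rV[R]_(n + 1)) y =
  row_mx ('D_v a y) ('D_v g y)%:M.
Proof.
move=> ad gd.
have E1 j : (fun z => (row_mx (a z) (g z)%:M : 'rV[R]_(n + 1)) 0 (lshift 1 j)) =
    (fun z => a z 0 j) by apply/funext => z; rewrite row_mxEl.
have E2 j : (fun z => (row_mx (a z) (g z)%:M : 'rV[R]_(n + 1)) 0 (rshift n j)) = g.
  by apply/funext => z; rewrite row_mxEr !ord1 mxE eqxx mulr1n.
rewrite derive_mx; last first.
  apply/derivable_mxP => i j; rewrite ord1; case: (split_ordP j) => k ->.
    by rewrite E1; move/derivable_mxP: ad; exact.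
  by rewrite E2.
apply/matrixP => i j; rewrite mxE !ord1; case: (split_ordP j) => k ->.
  by rewrite E1 row_mxEl derive_mx// mxE.
by rewrite E2 row_mxEr !ord1 mxE eqxx mulr1n.
Qed.

Lemma dot_row_mx {R : realType} {n : nat} (u v : 'rV[R]_n) (a b : R) :
  dot (row_mx u a%:M : 'rV[R]_(n + 1)) (row_mx v b%:M) = dot u v + a * b.
Proof.
rewrite /dot big_split_ord big_ord1 /=; congr (_ + _).
  by apply: eq_bigr => i _; rewrite !row_mxEl.
by rewrite !row_mxEr !mxE eqxx !mulr1n.
Qed.

Lemma dotZr {R : realType} {n : nat} (u v : 'rV[R]_n) (a : R) :
  dot u (a *: v) = a * dot u v.
Proof. by rewrite /dot mulr_sumr; apply: eq_bigr => i _; rewrite mxE; ring. Qed.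

Lemma dot_delta {R : realType} {n : nat} (i j : 'I_n) :
  dot (delta_mx 0 i : 'rV[R]_n) (delta_mx 0 j) = (i == j)%:R.
Proof.
rewrite /dot (bigD1 i)//= big1 => [|k ki]; rewrite !mxE !eqxx /= ?addr0 ?mul1r//.
by rewrite (negbTE ki) mul0r.
Qed.

Lemma dot0r {R : realType} {n : nat} (v : 'rV[R]_n) : dot 0 v = 0.
Proof. by rewrite /dot big1// => i _; rewrite mxE mul0r. Qed.

Section GraphForms.
Context {R : realType}.
Variable F : 'rV[R]_3 -> R.
Hypothesis smoothF : smooth F.

Let p y : 'rV[R]_3 := \row_i partial i F y.

Definition graph_slope y : R := Num.sqrt (1 + \sum_i partial i F y ^+ 2).

Lemma graph_slope_sqr y : graph_slope y ^+ 2 = 1 + \sum_i partial i F y ^+ 2.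
Proof. by rewrite sqr_sqrtr// addr_ge0// sumr_ge0// => i _; exact: sqr_ge0. Qed.

Lemma graph_slope_gt0 y : 0 < graph_slope y.
Proof. by rewrite sqrtr_gt0 ltr_pwDl// sumr_ge0// => i _; exact: sqr_ge0. Qed.

Lemma partial_graph_param i y : partial i (graph_param F) y =
  row_mx (delta_mx 0 i) (partial i F y)%:M :> 'rV[R]_(3 + 1).
Proof.
rewrite /partial (derive_row_mx id)//.
- by rewrite derive_id.
- exact/diff_derivable/(smoothF [::]).
Qed.

Lemma partial2_graph_param i j y : partial i (partial j (graph_param F)) y =
  row_mx 0 (partial i (partial j F) y)%:M :> 'rV[R]_(3 + 1).
Proof.
rewrite (_ : partial j (graph_param F) =
    fun z => row_mx (delta_mx 0 j) (partial j F z)%:M :> 'rV[R]_(3 + 1)); last first.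
  by apply/funext => z; rewrite partial_graph_param.
rewrite /partial (derive_row_mx (cst (delta_mx 0 j)))//.
- by rewrite derive_cst.
- exact/diff_derivable/(smoothF [:: j]).
Qed.

Lemma graph_first_form y :
  first_fundamental_form (graph_param F) y = 1 + (p y)^T *m p y.
Proof.
apply/matrixP => i j; rewrite !mxE big_ord1 !mxE !partial_graph_param.
by rewrite (dot_row_mx (delta_mx 0 i)) dot_delta.
Qed.

(** The second derivatives of the parametrization are vertical, so only the last component of the
    unit normal contributes. *)
Lemma graph_second_form y :
  second_fundamental_form (graph_param F) (graph_normal F) y =
  (graph_slope y)^-1 *: \matrix_(i, j) partial i (partial j F) y.
Proof.
apply/matrixP => i j; rewrite !mxE partial2_graph_param /graph_normal dotZr.
rewrite /graph_conormal !(@dot_row_mx R 3) dot0r add0r !mulr1.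
congr (_^-1 * _); rewrite /graph_slope addrC; congr (Num.sqrt (_ + _)).
by apply: eq_bigr => k _; rewrite !mxE mulrNN expr2.
Qed.

(** Multiplying by the metric removes the inverse; the metric is invertible because its determinant
    is [W ^+ 2]. *)
Lemma graph_shape_operator y :
  (1 + (p y)^T *m p y) *m shape_operator (graph_param F) (graph_normal F) y =
  (graph_slope y)^-1 *: \matrix_(i, j) partial i (partial j F) y.
Proof.
rewrite -graph_second_form -graph_first_form /shape_operator mulmxA mulmxV ?mul1mx//.
rewrite unitmxE unitfE graph_first_form det_add_outer.
under eq_bigr do rewrite mxE.
by rewrite -graph_slope_sqr expf_neq0// gt_eqF// graph_slope_gt0.
Qed.

End GraphForms.

(** * Constancy of sign and the contradiction *)

(** The intermediate value theorem along the segment from [x] to [y] would produce a zero if the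
    signs differed. *)
Lemma continuous_neq0_sgr {R : realType} {V : normedModType R} (f : V -> R) x y :
  continuous f -> (forall z, f z != 0) -> Num.sg (f x) = Num.sg (f y).
Proof.
move=> fc f0; apply/eqP; apply: contraT => sxy.
pose g (t : R) := f (t *: (y - x) + x).
have gc : continuous g.
  move=> t; apply: (@continuous_comp _ _ _ (fun t : R => t *: (y - x) + x) f).
    by apply: cvgD; [apply: cvgZr_tmp; exact: cvg_id|exact: cvg_cst].
  exact: fc.
have g0 : g 0 = f x by rewrite /g scale0r add0r.
have g1 : g 1 = f y by rewrite /g scale1r subrK.
have [||t _ gt] := @IVT R g 0 1 0 ler01.
- exact: continuous_subspaceT.
- rewrite g0 g1 ge_min le_max.
  have := f0 x; have := f0 y.
  rewrite [f y != 0]neq_lt [f x != 0]neq_lt => /orP[fy|fy] /orP[fx|fx].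
  + by rewrite (ltr0_sg fx) (ltr0_sg fy) eqxx in sxy.
  + by rewrite (ltW fx) (ltW fy) orbT.
  + by rewrite (ltW fx) (ltW fy) orbT.
  + by rewrite (gtr0_sg fx) (gtr0_sg fy) eqxx in sxy.
- by have := f0 (t *: (y - x) + x); rewrite -/(g t) gt eqxx.
Qed.

Theorem theoremB (R : realType) :
  ~ exists (F : 'rV[R]_3 -> R) (k : 'rV[R]_3 -> 'rV[R]_3),
      [/\ smooth F,
          forall y, graph_principal_curvatures F y (k y),
          forall y, scalar_curvature (k y) = 0
        & exists2 c : R, 0 < c &
            forall y, mean_curvature (k y) != 0 /\
              c <= - gauss_kronecker_curvature (k y) / mean_curvature (k y) ^+ 3].
Proof.
move=> [F [k [sF Fk k0 [c c0 kc]]]].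
pose u i := partial i F; pose P i j := partial i (partial j F).
pose T i j l := partial i (partial j (partial l F)).
pose Pm y : 'M[R]_3 := \matrix_(i, j) P i j y.
pose A y := shape_operator (graph_param F) (graph_normal F) y.
pose W := graph_slope F; pose H y := mean_curvature (k y).
pose K y := gauss_kronecker_curvature (k y).
have W0 y : 0 < W y by exact: graph_slope_gt0.
(* Only absolute values are kept here; a constant sign is recovered below from the Hessian
   determinant. *)
have Kc y : c * `|H y| ^+ 3 <= `|K y|.
  have [H0 cK] := kc y; rewrite -ler_pdivlMr ?exprn_gt0 ?normr_gt0//.
  rewrite (le_trans cK)// (le_trans (ler_norm _))//.
  by rewrite normrM normrN normfV normrX.
have K0 y : K y != 0.
  rewrite -normr_gt0 (lt_le_trans _ (Kc y))// mulr_gt0// exprn_gt0// normr_gt0.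
  by case: (kc y).
have PC i j : P i j = P j i by exact: (smooth_partialC _ sF [::]).
have Psym y : (Pm y)^T = Pm y by apply/matrixP => i j; rewrite !mxE PC.
have [geo_det geo_bound] : (forall y, \det (Pm y) = W y ^+ 5 * K y) /\
    (forall y i, `|\sum_j cof3 (Pm y) i j * u j y| <= 36 * W y ^+ 4 * H y ^+ 2).
  suff G y : \det (Pm y) = W y ^+ 5 * K y /\
    forall i, `|\sum_j cof3 (Pm y) i j * u j y| <= 36 * W y ^+ 4 * H y ^+ 2.
    by split=> y; have [] := G y.
  have [dA _ tA] := char_poly3_roots _ _ (Fk y).
  have A0 : \det (A y) != 0 by rewrite dA; exact: K0.
  have tA' : \tr (A y *m A y) = H y ^+ 2.
    rewrite tA -[X in _ - 2 * X]/(scalar_curvature (k y)) k0 mulr0 subr0.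
    by [].
  have W2 : W y ^+ 2 = 1 + \sum_i (\row_i partial i F y) 0 i ^+ 2.
    by rewrite graph_slope_sqr; under [in RHS]eq_bigr do rewrite mxE.
  have [d b] := graph_cofactor_bound _ _ _ _ _ (W0 y) W2 (Psym y) A0
    (graph_shape_operator _ sF y) tA'.
  split=> [|i]; first by rewrite d dA.
  by have := b i; under eq_bigr do rewrite [in X in _ * X]mxE.
have uc i : continuous (u i) by exact: (smooth_continuous _ sF [:: i]).
have Pc i j : continuous (P i j) by exact: (smooth_continuous _ sF [:: i; j]).
have Tc i j l : continuous (T i j l).
  exact: (smooth_continuous _ sF [:: i; j; l]).
have ud i j y : is_derive y (delta_mx 0 i) (u j) (P i j y).
  exact: (smooth_is_derive _ sF [:: j]).
have Pd i j l y : is_derive y (delta_mx 0 i) (P j l) (T i j l y).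
  exact: (smooth_is_derive _ sF [:: j; l]).
have Tij i j l : T i j l = T j i l by exact: (smooth_partialC _ sF [:: l]).
have Tjl i j l : T i j l = T i l j by rewrite /T (smooth_partialC _ sF [::]).
have hE y : hess_det P y = \det (Pm y).
  by rewrite det3E; apply: eq_bigr => j _; rewrite /cof3 !mxE.
have hc : continuous (hess_det P) by exact: hess_det_continuous.
have h0 y : hess_det P y != 0.
  by rewrite hE geo_det mulf_neq0// expf_neq0// gt_eqF.
have sE y : slope2 u y = W y ^+ 2 by rewrite graph_slope_sqr big_ord3.
pose Z := curvature_field u P.
have Zc i : continuous (Z i) by exact: curvature_field_continuous.
have [dZ [Zd dZc dZE]] :=
  curvature_field_derive u P T uc Pc Tc ud Pd PC Tij Tjl.
(* The Hessian determinant never vanishes, so its sign is constant; multiplying the field by it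
   makes the divergence positive everywhere. *)
pose t := Num.sg (hess_det P 0).
have tn : `|t| = 1 by rewrite normr_sg h0.
have DE y : \sum_i t * dZ i y = W y * (W y ^+ 2 + 2) * `|K y|.
  rewrite -mulr_sumr dZE sE /t (continuous_neq0_sgr _ 0 y hc h0).
  rewrite -[X in _ * X]mulrA [LHS]mulrA -normrEsg hE geo_det normrM gtr0_norm ?exprn_gt0//.
  by field; rewrite gt_eqF.
have tZd i y : is_derive y (delta_mx 0 i) (fun y => t * Z i y) (t * dZ i y).
  notypeclasses refine (is_derive_eq (is_derive_mulf (is_derive_cst t _ _) (Zd i y)) _).
  by rewrite mul0r add0r.
have tZc i : continuous (fun y => t * Z i y).
  by apply: continuous_mulf => //; exact: cst_continuous.
have tdZc i : continuous (fun y => t * dZ i y).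
  by apply: continuous_mulf => //; exact: cst_continuous.
apply: (liouville_field _ _ 36 c (ltr0n _ 36) c0 tZd tZc tdZc) => y; last first.
  rewrite DE !mulr_gt0 ?normr_gt0// addr_gt0// exprn_gt0//.
(* With this scale, the cofactor bound divided by [W ^+ 2] is [36 * x ^+ 2], and the divergence is
   at least [W ^+ 3 * |K|], hence at least [c * x ^+ 3]. *)
exists (W y * `|H y|); split.
- by rewrite mulr_ge0// ltW.
- move=> i; rewrite normrM tn mul1r /Z /curvature_field normrM normfV sE.
  rewrite [`|W y ^+ 2|]gtr0_norm ?exprn_gt0// ler_pdivrMr ?exprn_gt0//.
  have -> : 36 * (W y * `|H y|) ^+ 2 * W y ^+ 2 = 36 * W y ^+ 4 * H y ^+ 2.
    by rewrite -[H y ^+ 2]real_normK ?num_real//; ring.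
  apply: le_trans (geo_bound y i); rewrite le_eqVlt; apply/orP; left; apply/eqP.
  by congr `|_|; apply: eq_bigr => j _; rewrite /cof3 !mxE.
- rewrite DE (@le_trans _ _ (W y ^+ 3 * `|K y|))//.
    by rewrite exprMn mulrCA ler_wpM2l// exprn_ge0// ltW.
  by rewrite ler_wpM2r// exprS ler_wpM2l ?(ltW (W0 y))// lerDl.
Qed.
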